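(* Let $\varphi(z)$ be a given strictly proper rational $m_1\times m_2$ matrix function. Then there is a unique discrete skew-selfadjoint Dirac system $$y_{k+1}(z)=\Big(I_m+\frac{\mathrm{i}}{z}C_k\Big)y_k(z),\qquad C_k=U_k^*jU_k\quad(k\in\mathbb{N}_0),\quad U_k \text{ unitary},$$ such that its potential $\{C_k\}$ belongs to the class FG and $\varphi(z)$ is its Weyl function.
   Context: $m=m_1+m_2$, $j=\mathrm{diag}\{I_{m_1},-I_{m_2}\}$, $\mathbb{N}_0=\{0,1,2,\dots\}$, $\mathbb{N}=\{1,2,\dots\}$; $X>0$ means that $X$ is Hermitian with all eigenvalues positive. A rational matrix function is strictly proper if it tends to zero at infinity. Weyl function: the Weyl function of the system is an $m_1\times m_2$ matrix function $\varphi(z)$ in $\mathbb{C}_M=\{z:\Im z>M\}$ (for some $M>0$) which satisfies there the inequality $$\sum_{k=0}^\infty\begin{bmatrix}\varphi(z)^*&I_{m_2}\end{bmatrix}w_k(z)^*w_k(z)\begin{bmatrix}\varphi(z)\\ I_{m_2}\end{bmatrix}<\infty,$$ where $w_k(z)$ is the fundamental ($m\times m$ matrix) solution of the system normalized by $w_0(z)\equiv I_m$. A rational Weyl function is extended from $\mathbb{C}_M$ to $\mathbb{C}$ in the natural way. Let $n\in\mathbb{N}$. A quadruple $\{\alpha,S_0,\vartheta_1,\vartheta_2\}$ of complex $n\times n$ matrices $\alpha,S_0$ and $n\times m_k$ matrices $\vartheta_k$ ($k=1,2$) is admissible if $S_0>0$ and $\alpha S_0-S_0\alpha^*=\mathrm{i}(\vartheta_1\vartheta_1^*+\vartheta_2\vartheta_2^*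 )$. A pair $\{\alpha,\vartheta\}$ is controllable if $\mathrm{span}\bigcup_{k=0}^{n-1}\mathrm{Im}(\alpha^k\vartheta)=\mathbb{C}^n$, where $\mathrm{Im}$ denotes the image. The quadruple is strongly admissible if it is admissible and both pairs $\{\alpha,\vartheta_1\}$ and $\{\alpha,\vartheta_2\}$ are controllable. The potential generated by the quadruple is $$C_k=j+\Lambda_k^*S_k^{-1}\Lambda_k-\Lambda_{k+1}^*S_{k+1}^{-1}\Lambda_{k+1}\quad(k\in\mathbb{N}_0),$$ $$\Lambda_0=\begin{bmatrix}\vartheta_1&\vartheta_2\end{bmatrix},\quad \Lambda_{k+1}=\Lambda_k+\mathrm{i}\alpha^{-1}\Lambda_kj,\quad S_{k+1}=S_k+\alpha^{-1}S_k(\alpha^* )^{-1}+\alpha^{-1}\Lambda_kj\Lambda_k^*(\alpha^* )^{-1}.$$ (For an admissible quadruple with $\{\alpha,\vartheta_1\}$ controllable, it is known that $\alpha$ is invertible, all $S_k>0$, and each $C_k$ has the form $U_k^*jU_k$ with $U_k$ unitary.) The class FG (finitely generated potentials) consists of all potentials $\{C_k\}$ generated by strongly admissible quadruples (the order $n\in\mathbb{N}$ is not fixed in advance).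
   Formalization: The function φ is assumed not identically zero (and m_1, m_2 ≥ 1): since quadruples have order n ≥ 1, strong admissibility makes the Weyl function of any system in FG nonzero, so no such system exists for φ = 0. *)

(* Defs.v *)
From mathcomp Require Import all_boot all_order all_algebra.
From mathcomp Require Import complex.
From mathcomp Require Import all_classical all_reals all_analysis.

Set Implicit Arguments.
Unset Strict Implicit.
Unset Printing Implicit Defensive.

Import Order.TTheory GRing.Theory Num.Theory numFieldNormedType.Exports.
Local Open Scope ring_scope.
Local Open Scope complex_scope.
Local Open Scope sesquilinear_scope.

(* The complex numbers are [R[i]] with [R : realType]; [A ^t*] is the
   conjugate transpose. *)

Definition sigj (R : realType) (m1 m2 : nat) : 'M[R[i]]_(m1 + m2) :=
  block_mx 1%:M 0 0 (- 1%:M).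

Definition posdef (R : realType) (n : nat) (X : 'M[R[i]]_n) : Prop :=
  X \is hermsymmx /\ forall a : R[i], eigenvalue X a -> 0 < a.

(* MathComp subspaces are row spaces, so the image (column space) of
   [alpha ^+ k *m theta] is the row space of its transpose. *)
Definition controllable (R : realType) (n p : nat)
    (alpha : 'M[R[i]]_n) (theta : 'M[R[i]]_(n, p)) : Prop :=
  row_full (\sum_(k < n) <<(alpha ^+ k *m theta)^T>>)%MS.

Definition admissible (R : realType) (n m1 m2 : nat) (alpha S0 : 'M[R[i]]_n)
    (theta1 : 'M[R[i]]_(n, m1)) (theta2 : 'M[R[i]]_(n, m2)) : Prop :=
  posdef S0 /\
  alpha *m S0 - S0 *m alpha^t* =
    'i *: (theta1 *m theta1^t* + theta2 *m theta2^t*).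

Definition strongly_admissible (R : realType) (n m1 m2 : nat)
    (alpha S0 : 'M[R[i]]_n)
    (theta1 : 'M[R[i]]_(n, m1)) (theta2 : 'M[R[i]]_(n, m2)) : Prop :=
  [/\ admissible alpha S0 theta1 theta2,
      controllable alpha theta1 & controllable alpha theta2].

Fixpoint Lam (R : realType) (n m1 m2 : nat) (alpha : 'M[R[i]]_n)
    (theta1 : 'M[R[i]]_(n, m1)) (theta2 : 'M[R[i]]_(n, m2)) (k : nat) :
    'M[R[i]]_(n, m1 + m2) :=
  match k with
  | 0 => row_mx theta1 theta2
  | k'.+1 => let L := Lam alpha theta1 theta2 k' in
             L + 'i *: (invmx alpha *m L *m sigj R m1 m2)
  end.

Fixpoint Smx (R : realType) (n m1 m2 : nat) (alpha S0 : 'M[R[i]]_n)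
    (theta1 : 'M[R[i]]_(n, m1)) (theta2 : 'M[R[i]]_(n, m2)) (k : nat) :
    'M[R[i]]_n :=
  match k with
  | 0 => S0
  | k'.+1 => let L := Lam alpha theta1 theta2 k' in
             let S := Smx alpha S0 theta1 theta2 k' in
             S + invmx alpha *m S *m invmx (alpha^t*)
               + invmx alpha *m L *m sigj R m1 m2 *m L^t* *m invmx (alpha^t*)
  end.

Definition potential (R : realType) (n m1 m2 : nat) (alpha S0 : 'M[R[i]]_n)
    (theta1 : 'M[R[i]]_(n, m1)) (theta2 : 'M[R[i]]_(n, m2)) (k : nat) :
    'M[R[i]]_(m1 + m2) :=
  let L := Lam alpha theta1 theta2 in
  let S := Smx alpha S0 theta1 theta2 in
  sigj R m1 m2 + (L k)^t* *m invmx (S k) *m L k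
               - (L k.+1)^t* *m invmx (S k.+1) *m L k.+1.

Definition FG (R : realType) (m1 m2 : nat)
    (C : nat -> 'M[R[i]]_(m1 + m2)) : Prop :=
  exists (n : nat) (alpha S0 : 'M[R[i]]_n)
         (theta1 : 'M[R[i]]_(n, m1)) (theta2 : 'M[R[i]]_(n, m2)),
    [/\ (0 < n)%N, strongly_admissible alpha S0 theta1 theta2
      & forall k, C k = potential alpha S0 theta1 theta2 k].

(* A system is identified with its potential. *)
Definition dirac_potential (R : realType) (m1 m2 : nat)
    (C : nat -> 'M[R[i]]_(m1 + m2)) : Prop :=
  forall k, exists2 U : 'M[R[i]]_(m1 + m2),
    U \is unitarymx & C k = U^t* *m sigj R m1 m2 *m U.

Fixpoint fundamental (R : realType) (m : nat) (C : nat -> 'M[R[i]]_m)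
    (z : R[i]) (k : nat) : 'M[R[i]]_m :=
  match k with
  | 0 => 1%:M
  | k'.+1 => (1%:M + ('i / z) *: C k') *m fundamental C z k'
  end.

Definition weyl_term (R : realType) (m1 m2 : nat)
    (C : nat -> 'M[R[i]]_(m1 + m2)) (phi : R[i] -> 'M[R[i]]_(m1, m2))
    (z : R[i]) (k : nat) : 'M[R[i]]_m2 :=
  row_mx ((phi z)^t* ) 1%:M *m (fundamental C z k)^t* *m fundamental C z k
    *m col_mx (phi z) 1%:M.

(* The cast to [numFieldType] gives access to the topology of matrices over
   a normed field. *)
Definition weyl_function (R : realType) (m1 m2 : nat)
    (C : nat -> 'M[R[i]]_(m1 + m2)) (phi : R[i] -> 'M[R[i]]_(m1, m2)) : Prop :=
  exists2 M : R, 0 < M &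
    forall z : R[i], M < complex.Im z ->
      cvgn (series (weyl_term C phi z : nat -> 'M[R[i] : numFieldType]_m2)).

(* Entrywise a quotient of coprime polynomials; the values of the total
   function [phi] at the (finitely many) poles are irrelevant. *)
Definition rational_mxfun (R : realType) (m1 m2 : nat)
    (phi : R[i] -> 'M[R[i]]_(m1, m2)) : Prop :=
  forall i j, exists p q : {poly R[i]},
    [/\ q != 0, coprimep p q
      & forall z, q.[z] != 0 -> phi z i j = p.[z] / q.[z]].

Definition strictly_proper (R : realType) (m1 m2 : nat)
    (phi : R[i] -> 'M[R[i]]_(m1, m2)) : Prop :=
  forall eps : R[i], 0 < eps -> exists2 B : R[i], 0 < B &
    forall z, B < `|z| -> forall i j, `|phi z i j| < eps.

(* Main.v *)
(* With gamma = alpha - i theta_2 theta_2^* S_0^-1, the Darboux matrices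
   w(k, z) = I - i Lambda_k^* S_k^-1 (alpha + z)^-1 Lambda_k intertwine the system of a
   quadruple with the one whose potential is constantly j.  Since w(k, z) is
   contractive for Im z > 0, and bounded below on the first block uniformly in k, the
   square summable solutions for large Im z are exactly those generated by
   phi(z) = - i theta_1^* S_0^-1 (gamma + z)^-1 theta_2; so this is the only Weyl
   function.

   Existence: take a minimal realization phi(z) = c (z - A)^-1 B, put gamma = - A,
   theta_2 = B, and write c = - i h with h = theta_1^* S_0^-1.  The quadruple is
   admissible iff S_0 solves the Riccati equation
   gamma X - X gamma^* = i X h^* h X - i B B^*, whose positive definite solution comes
   from the spectral subspace of the associated Hamiltonian matrix for the lower half
   plane.

   Uniqueness: two quadruples with the same Weyl function give minimal realizations of
   it, hence similar ones; uniqueness of the positive definite solution of the Riccati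
   equation makes the quadruples similar, and similar quadruples have the same
   potential. *)
From mathcomp Require Import all_boot all_order all_algebra ring.
Set Implicit Arguments.
Unset Strict Implicit.
Unset Printing Implicit Defensive.
Import Order.TTheory GRing.Theory Num.Theory.
Local Open Scope ring_scope.
Local Open Scope sesquilinear_scope.

(** * Adjoints and positive definite matrices *)

Section Adjoint.
Context (C : numClosedFieldType).

(** Two facts about matrix equations carry the algebra: [A X = X B] has only the zero solution when
    the spectra are disjoint, and a Hermitian [Y] with [A Y - Y A^t* = 'i P], [P >= 0], is
    nonnegative when the spectrum of [A] lies in the upper half plane. Both are proved with
    eigenvectors, so analysis enters only with the summation of the Weyl series.

    Under the constant potential [j] each step multiplies the blocks by [1 + 'i / z] and
    [1 - 'i / z]. For [Im z >= 1] the second factor has modulus below 1 and the first at least 1.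
    This alone does not prevent the first block from being summable, since the contractions
    [w(k, z)] might compress it; hence the bound from below, uniform in [k].

    Summability gives information on a half plane, a realization describes [phi] near infinity.
    Every neighbourhood of infinity meets every such half plane, which suffices to determine all
    coefficients [c A^k B].

    The function [phi = 0] has to be excluded: its minimal realization has order 0, whereas FG asks
    for a positive order. *)

Lemma adjD m n (A B : 'M[C]_(m, n)) : (A + B)^t* = A^t* + B^t*.
Proof. by rewrite linearD map_mxD. Qed.
Lemma adjN m n (A : 'M[C]_(m, n)) : (- A)^t* = - A^t*.
Proof. by rewrite linearN map_mxN. Qed.
Lemma adj0 m n : (0 : 'M[C]_(m, n))^t* = 0.
Proof. by rewrite trmx0 map_mx0. Qed.
Lemma adjZ m n a (A : 'M[C]_(m, n)) : (a *: A)^t* = a^* *: A^t*.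
Proof. by rewrite linearZ map_mxZ. Qed.
Lemma adjM m n p (A : 'M[C]_(m, n)) (B : 'M_(n, p)) :
  (A *m B)^t* = B^t* *m A^t*.
Proof. by rewrite trmx_mul map_mxM. Qed.
Lemma adj1 n : (1%:M : 'M[C]_n)^t* = 1%:M.
Proof. by rewrite trmx1 map_mx1. Qed.
Lemma adjS n (a : C) : (a%:M : 'M[C]_n)^t* = (a^*)%:M.
Proof. by rewrite tr_scalar_mx map_scalar_mx. Qed.
Lemma adjV n (A : 'M[C]_n) : (invmx A)^t* = invmx (A^t*).
Proof. by rewrite trmx_inv map_invmx. Qed.
Lemma adj_unit n (A : 'M[C]_n) : (A^t* \in unitmx) = (A \in unitmx).
Proof. by rewrite map_unitmx unitmx_tr. Qed.
Lemma adj_row m n1 n2 (A : 'M[C]_(m, n1)) (B : 'M_(m, n2)) :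
  (row_mx A B)^t* = col_mx (A^t*) (B^t*).
Proof. by rewrite tr_row_mx map_col_mx. Qed.
Lemma adj_col m1 m2 n (A : 'M[C]_(m1, n)) (B : 'M_(m2, n)) :
  (col_mx A B)^t* = row_mx (A^t*) (B^t*).
Proof. by rewrite tr_col_mx map_row_mx. Qed.
Lemma adj_block m1 m2 n1 n2 (A : 'M[C]_(m1, n1)) (B : 'M_(m1, n2))
    (D : 'M_(m2, n1)) (E : 'M_(m2, n2)) :
  (block_mx A B D E)^t* = block_mx (A^t*) (D^t*) (B^t*) (E^t*).
Proof. by rewrite tr_block_mx map_block_mx. Qed.
Lemma adj_inj m n (A B : 'M[C]_(m, n)) : A^t* = B^t* -> A = B.
Proof. by move=> e; rewrite -[A]trmxCK e trmxCK. Qed.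
Lemma adjE m n (A : 'M[C]_(m, n)) i j : A^t* i j = (A j i)^*.
Proof. by rewrite !mxE. Qed.

Lemma mxaddE m n (A B : 'M[C]_(m, n)) i j : (A + B) i j = A i j + B i j.
Proof. by rewrite mxE. Qed.
Lemma mxoppE m n (A : 'M[C]_(m, n)) i j : (- A) i j = - A i j.
Proof. by rewrite mxE. Qed.
Lemma mxscaleE m n a (A : 'M[C]_(m, n)) i j : (a *: A) i j = a * A i j.
Proof. by rewrite mxE. Qed.
Lemma mxzeroE m n i j : (0 : 'M[C]_(m, n)) i j = 0.
Proof. by rewrite mxE. Qed.

Lemma conj_i : ('i : C)^* = - 'i. Proof. exact: conjCi. Qed.

Lemma conj_Ni : (- 'i : C)^* = 'i. Proof. by rewrite rmorphN /= conjCi opprK. Qed.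

Lemma mulmxZl m n p a (A : 'M[C]_(m, n)) (B : 'M_(n, p)) :
  (a *: A) *m B = a *: (A *m B).
Proof. by rewrite scalemxAl. Qed.
Lemma mulmxZr m n p a (A : 'M[C]_(m, n)) (B : 'M_(n, p)) :
  A *m (a *: B) = a *: (A *m B).
Proof. by rewrite scalemxAr. Qed.

End Adjoint.

Ltac adjn := rewrite ?(adjD, adjN, adjZ, adjM, adj1, adjS, adjV, trmxCK, adj0,
   conj_i, conj_Ni, rmorphN, rmorph1, conjCK).
Ltac mxnorm := rewrite ?(mulmxDl, mulmxDr, mulmxBl, mulmxBr, mulNmx, mulmxN,
   mul_scalar_mx, mul_mx_scalar, mulmxZl, mulmxZr, mulmxA, mul1mx, mulmx1,
   mul0mx, mulmx0, scaler0, scale0r).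
Ltac mxent := apply/matrixP => ? ?;
  rewrite ?(mxaddE, mxoppE, mxscaleE, mxzeroE).
Ltac mxring := mxnorm; mxent; ring.
Tactic Notation "mxringi" constr(K) := mxnorm; mxent; ring: (sqrCi K).

Section Psd.
Context (C : numClosedFieldType).

(** Forms on row vectors, because the eigenvectors behind [eigenvalue] are rows. *)
Definition psd n (P : 'M[C]_n) : Prop :=
  P^t* = P /\ forall x : 'rV_n, 0 <= (x *m P *m x^t*) 0 0.
Definition pd n (P : 'M[C]_n) : Prop :=
  P^t* = P /\ forall x : 'rV_n, x != 0 -> 0 < (x *m P *m x^t*) 0 0.

Lemma rV_normE n (x : 'rV[C]_n) : (x *m x^t*) 0 0 = \sum_i `|x 0 i| ^+ 2.
Proof. by rewrite mxE; apply: eq_bigr => i _; rewrite adjE -normCK. Qed.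

Lemma rV_norm_ge0 n (x : 'rV[C]_n) : 0 <= (x *m x^t*) 0 0.
Proof. by rewrite rV_normE; apply: sumr_ge0 => i _; apply: exprn_ge0. Qed.

Lemma rV_norm_eq0 n (x : 'rV[C]_n) : (x *m x^t*) 0 0 = 0 -> x = 0.
Proof.
rewrite rV_normE => /eqP; rewrite psumr_eq0 => [/allP h|i _]; last exact: exprn_ge0.
apply/rowP=> i; rewrite mxE; apply/eqP.
by have := h i (mem_index_enum _); rewrite /= sqrf_eq0 normr_eq0.
Qed.

Lemma pd_psd n (P : 'M[C]_n) : pd P -> psd P.
Proof.
move=> [hP h]; split=> // x; have [->|/h/ltW//] := eqVneq x 0.
by rewrite !mul0mx mxE.
Qed.

Lemma psdD n (P Q : 'M[C]_n) : psd P -> psd Q -> psd (P + Q).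
Proof.
move=> [hP pP] [hQ pQ]; split; first by rewrite adjD hP hQ.
by move=> x; rewrite mulmxDr mulmxDl mxE addr_ge0.
Qed.

Lemma psd_gram m n (A : 'M[C]_(m, n)) : psd (A *m A^t*).
Proof.
split; first by rewrite adjM trmxCK.
by move=> x; rewrite !mulmxA -mulmxA -adjM; apply: rV_norm_ge0.
Qed.

Lemma pd_unit n (P : 'M[C]_n) : pd P -> P \in unitmx.
Proof.
move=> [_ h]; rewrite -row_free_unit; apply/inj_row_free => v vP0.
by apply/eqP/negP=> /negP /h; rewrite vP0 mul0mx mxE ltxx.
Qed.

Lemma pd_cong n (T P : 'M[C]_n) : T \in unitmx -> pd P -> pd (T *m P *m T^t*).
Proof.
move=> uT [hP h]; split; first by rewrite !adjM trmxCK hP mulmxA.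
move=> x x0.
have -> : x *m (T *m P *m T^t*) *m x^t* = (x *m T) *m P *m (x *m T)^t*.
  by rewrite adjM !mulmxA.
apply: h; apply/eqP => /(congr1 (mulmx^~ (invmx T))).
by rewrite mulmxK // mul0mx => /eqP; rewrite (negPf x0).
Qed.

Lemma pd_inv n (P : 'M[C]_n) : pd P -> pd (invmx P).
Proof.
move=> dP; have uP := pd_unit dP; have hP := dP.1.
have -> : invmx P = invmx P *m P *m (invmx P)^t*.
  by rewrite adjV hP mulVmx // mul1mx.
by apply: pd_cong; rewrite ?unitmx_inv.
Qed.

(* The form of [P] is nonnegative at [x - t (x P)] for every real [t]. *)
Lemma psd_ker n (P : 'M[C]_n) (x : 'rV_n) :
  psd P -> (x *m P *m x^t*) 0 0 = 0 -> x *m P = 0.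
Proof.
move=> [hP pP] x0.
apply: rV_norm_eq0; set y := x *m P.
set a := (y *m y^t*) 0 0.
have a_ge0 : 0 <= a by apply: rV_norm_ge0.
set b := (y *m P *m y^t*) 0 0.
have b_ge0 : 0 <= b by apply: pP.
have key (t : C) : t \is Num.real -> 0 <= - (2 * t * a) + t ^+ 2 * b.
  move=> tr; have := pP (x - t *: y).
  have -> : ((x - t *: y) *m P *m (x - t *: y)^t*) =
     x *m P *m x^t* - t *: (x *m P *m y^t*) - t *: (y *m P *m x^t*)
     + t ^+ 2 *: (y *m P *m y^t*).
    by rewrite adjD adjN adjZ (CrealP tr); mxring.
  have -> : y *m P *m x^t* = y *m y^t* by rewrite {3}/y adjM hP mulmxA.
  rewrite !(mxaddE, mxoppE, mxscaleE) x0 -/a -/b.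
  by congr (0 <= _); rewrite -/y; rewrite -/a; ring.
(* For [b > 0] the best [t] is [a / b]; the denominator [1 + b] works as well and covers [b = 0]. *)
have tr : a / (1 + b) \is Num.real by rewrite ger0_real // divr_ge0 ?addr_ge0.
have := key _ tr.
have b1 : 0 < 1 + b by rewrite ltr_wpDr.
have -> : - (2 * (a / (1 + b)) * a) + (a / (1 + b)) ^+ 2 * b
   = - (a ^+ 2 * (2 + b) / (1 + b) ^+ 2) by field; rewrite gt_eqF.
rewrite oppr_ge0 pmulr_lle0 ?invr_gt0 ?exprn_gt0 // pmulr_lle0; last first.
  by rewrite ltr_wpDr.
move=> h; apply/eqP; rewrite -sqrf_eq0; apply/eqP/le_anti.
by rewrite h exprn_ge0.
Qed.

End Psd.

(** * Sylvester and Lyapunov equations *)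

Section Eigen.
Context (C : numClosedFieldType).

Lemma eigenvalue_unitmx n (A : 'M[C]_n) a :
  eigenvalue A a = (A - a%:M \notin unitmx).
Proof. by rewrite /eigenvalue /eigenspace kermx_eq0 row_free_unit. Qed.

Lemma eigenvalue_tr n (A : 'M[C]_n) a : eigenvalue A^T a = eigenvalue A a.
Proof. by rewrite !eigenvalue_unitmx -unitmx_tr linearB /= trmxK tr_scalar_mx. Qed.

Lemma eigenvalue_adj n (A : 'M[C]_n) a : eigenvalue (A^t*) a = eigenvalue A a^*.
Proof. by rewrite !eigenvalue_unitmx -adj_unit; adjn. Qed.

Lemma eigenvalue_opp n (A : 'M[C]_n) a : eigenvalue (- A) a = eigenvalue A (- a).
Proof.
rewrite !eigenvalue_unitmx; congr (~~ _).
have -> : - A - a%:M = (-1) *: (A - (- a)%:M).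
  by rewrite scaleN1r opprB [in RHS]raddfN addrC.
by rewrite unitmxZ // unitrN1.
Qed.

Lemma eigenvector_in m n (E : 'M[C]_(m, n)) (G : 'M_n) (G' : 'M_m) :
  (0 < m)%N -> row_free E -> E *m G = G' *m E ->
  exists mu (y : 'rV_m), [/\ y *m E != 0, y *m G' = mu *: y
    & y *m E *m G = mu *: (y *m E)].
Proof.
move=> m0 fE h; have [mu /eigenvalueP[y hy y0]] := eigenvalue_closed G' m0.
exists mu, y; split=> //.
  by apply: contra y0 => /eqP yE; apply/eqP/(row_free_inj fE); rewrite /= mul0mx.
by rewrite -mulmxA h mulmxA hy mulmxZl.
Qed.

(** The left kernel of [U] is invariant under [G], so it contains an eigenvector as soon as it is
    nonzero. This reduces injectivity claims to eigenvectors, where controllability applies. *)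
Lemma eigenvector_ker n p (G : 'M[C]_n) (U : 'M_(n, p)) :
  ~~ row_free U -> (forall x : 'rV_n, x *m U = 0 -> x *m G *m U = 0) ->
  exists mu (x : 'rV_n), [/\ x != 0, x *m U = 0 & x *m G = mu *: x].
Proof.
rewrite -kermx_eq0 -mxrank_eq0 -lt0n => r0 h.
set E := row_base (kermx U).
have EU : E *m U = 0.
  by apply/sub_kermxP; rewrite eq_row_base.
have /submxP[G' hG] : (E *m G <= E)%MS.
  rewrite eq_row_base; apply/row_subP => i; apply/sub_kermxP.
  rewrite row_mul; apply: h.
  by rewrite -row_mul EU row0.
have [mu [y [y0 _ yG]]] := eigenvector_in r0 (row_base_free _) hG.
by exists mu, (y *m E); split; rewrite // -mulmxA EU mulmx0.
Qed.

(* Writing [X = L R] with [L] injective and [R] surjective, both [A] and [B]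
   induce the same operator on the middle space. *)
Lemma sylvester_eq0 m n (A : 'M[C]_m) (B : 'M_n) (X : 'M_(m, n)) :
  (forall a, eigenvalue A a -> eigenvalue B a -> False) ->
  A *m X = X *m B -> X = 0.
Proof.
move=> hAB hX; apply/eqP; rewrite -mxrank_eq0 -leqn0 leqNgt; apply/negP=> r0.
set R := row_base X; set L := col_base X.
have XE : L *m R = X by rewrite mulmx_base.
have fR : row_free R by apply: row_base_free.
have fL : row_free L^T by rewrite /row_free mxrank_tr; apply: col_base_full.
have /submxP[B' hB] : (R *m B <= R)%MS.
  by rewrite eq_row_base (eqmxMr B (eq_row_base X)) -hX submxMl.
have hL : A *m L = L *m B'.
  by apply: (row_free_inj fR); rewrite /= -(mulmxA A) XE -(mulmxA L) -hB mulmxA XE.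
have hL' : L^T *m A^T = B'^T *m L^T by rewrite -!trmx_mul hL.
have [mu [y [y0 yB yA]]] := eigenvector_in r0 fL hL'.
have y0' : y != 0 by apply: contraNneq y0 => ->; rewrite mul0mx.
apply: (hAB mu).
  by rewrite -eigenvalue_tr; apply/eigenvalueP; exists (y *m L^T).
have : eigenvalue B' mu.
  by rewrite -eigenvalue_tr; apply/eigenvalueP; exists y.
case/eigenvalueP=> v vB v0; apply/eigenvalueP; exists (v *m R).
  by rewrite -mulmxA hB mulmxA vB mulmxZl.
by apply: contra v0 => /eqP vR; apply/eqP/(row_free_inj fR); rewrite /= mul0mx.
Qed.

Lemma complete_row n (u : 'rV[C]_n.+1) :
  u != 0 -> exists E : 'M_(n, n.+1), (col_mx u E : 'M_(1 + n)) \in unitmx.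
Proof.
move=> u0; have rC : \rank (u^C)%MS = n by rewrite mxrank_compl rank_rV u0 subn1.
have := eq_row_base (u^C)%MS; move: (row_base _); rewrite rC => E hE.
exists E; rewrite -row_full_unit /row_full -addsmxE (adds_eqmx (eqmx_refl u) hE).
exact: addsmx_compl_full.
Qed.

(* Induction on [n]: split off a left eigenvector [u] of [A] together with its
   [Y]-orthogonal complement [E], on which [A] induces [A']. *)
Lemma lyapunov_psd n (A Y P : 'M[C]_n) :
  (forall a, eigenvalue A a -> 0 < 'Im a) -> Y^t* = Y -> psd P ->
  A *m Y - Y *m A^t* = 'i *: P -> psd Y.
Proof.
elim: n A Y P => [|n IH] A Y P hA hY pP e.
  by split=> // x; rewrite thinmx0 mul0mx mxE.
have [lam hlam] := eigenvalue_closed A (ltn0Sn n).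
have lam_gt0 := hA _ hlam.
have /eigenvalueP[u uA u0] := hlam.
have lamJ : lam - lam^* = 'i * (2 * 'Im lam).
  by rewrite {1 2}[lam]Crect conjC_rect ?Creal_Re ?Creal_Im //; ring.
set y := (u *m Y *m u^t*) 0 0.
have AuJ : A^t* *m u^t* = lam^* *: u^t* by rewrite -adjM uA adjZ.
have py : (u *m P *m u^t*) 0 0 = 2 * 'Im lam * y.
  apply: (mulfI (neq0Ci C)).
  rewrite mulrA -lamJ -mxscaleE -mulmxZl -mulmxZr -e.
  rewrite mulmxBr mulmxBl -!mulmxA AuJ !mulmxA uA !mulmxZl !mulmxZr.
  by rewrite mxaddE mxoppE !mxscaleE -/y; ring.
have y_ge0 : 0 <= y.
  by have := pP.2 u; rewrite py pmulr_rge0 // mulr_gt0.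
(* Otherwise [u Y] would be an eigenvector of [A^t*] for [lam], putting [lam^*] in the spectrum of
   [A] although it lies below the real axis. *)
have uY0 : y = 0 -> u *m Y = 0.
  move=> y0; have uP : u *m P = 0 by apply: psd_ker; rewrite // py y0 mulr0.
  apply/eqP/negP=> /negP uY; have : eigenvalue (A^t*) lam.
    apply/eigenvalueP; exists (u *m Y) => //.
    have /eqP := congr1 (mulmx u) e.
    by rewrite mulmxZr uP scaler0 mulmxBr subr_eq0 !mulmxA uA mulmxZl => /eqP.
  rewrite eigenvalue_adj => /hA; rewrite Im_conj oppr_gt0 => /(lt_trans lam_gt0).
  by rewrite ltxx.
have [E0 uT] := complete_row u0.
set c := E0 *m Y *m u^t*.
(* Gram-Schmidt for the form of [Y]. If [y = 0] then [y^-1 = 0] and [E = E0]; orthogonality then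
   comes from [u Y = 0]. *)
pose E := E0 - y^-1 *: (c *m u).
have dec m (M : 'M[C]_(m, n.+1)) : exists a V, M = a *m u + V *m E.
  have : M = (M *m invmx (col_mx u E0) : 'M_(m, 1 + n)) *m col_mx u E0.
    by rewrite mulmxKV.
  set N : 'M_(m, 1 + n) := M *m _ => ->.
  rewrite -[N]hsubmxK mul_row_col; set a := lsubmx _; set V := rsubmx _.
  exists (a + y^-1 *: (V *m c)), V; rewrite /E; mxring.
have EYu : E *m Y *m u^t* = 0.
  have [y0|y0] := eqVneq y 0.
    have Yu : Y *m u^t* = 0 by rewrite -hY -adjM uY0 // adj0.
    by rewrite -mulmxA Yu mulmx0.
  rewrite /E !mulmxBl -/c !mulmxZl -(mulmxA c) -(mulmxA c).
  rewrite [u *m Y *m _]mx11_scalar -/y.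
  by rewrite mul_mx_scalar scalerA mulVf // scale1r subrr.
have uYE : u *m Y *m E^t* = 0.
  by apply: adj_inj; rewrite !adjM trmxCK hY adj0 mulmxA.
have inj (a : 'M_1) (v : 'rV_n) : a *m u + v *m E = 0 -> v = 0.
  have -> : a *m u + v *m E = row_mx (a - y^-1 *: (v *m c)) v *m col_mx u E0.
    by rewrite mul_row_col /E; mxring.
  move=> /(congr1 (mulmx^~ (invmx (col_mx u E0)))); rewrite mulmxK // mul0mx.
  by rewrite -row_mx0 => /eq_row_mx[].
clearbody E.
have [r [A' EA]] := dec _ (E *m A).
have psdY' : psd (E *m Y *m E^t*).
  apply: (IH A' _ (E *m P *m E^t*)).
  - move=> mu /eigenvalueP[v vA v0].
    have [->//|ne] := eqVneq mu lam.
    apply: hA; apply/eigenvalueP.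
    (* An eigenvector of [A'] is lifted to [A]; the coefficient [x] of [u] solves
       [(mu - lam) x = v r], whence the separate case [mu = lam]. *)
    exists ((mu - lam)^-1 *: (v *m r) *m u + v *m E); last first.
      by apply: contra v0 => /eqP /inj ->.
    rewrite mulmxDl -!mulmxA EA uA mulmxDr (mulmxA v A') vA.
    by mxnorm; mxent; field; rewrite subr_eq0.
  - by rewrite !adjM trmxCK hY mulmxA.
  - have [hP pP'] := pP; split; first by rewrite !adjM trmxCK hP mulmxA.
    by move=> x; have := pP' (x *m E); rewrite adjM !mulmxA.
  - have -> : A' *m (E *m Y *m E^t*) = E *m A *m Y *m E^t*.
      by rewrite EA mulmxDl mulmxDl -!(mulmxA r) uYE mulmx0 add0r !mulmxA.
    have -> : E *m Y *m E^t* *m A'^t* = E *m Y *m A^t* *m E^t*.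
      rewrite -!(mulmxA (E *m Y)) -!adjM EA adjD mulmxDr.
      by rewrite [(r *m u)^t*]adjM mulmxA EYu mul0mx add0r.
    by rewrite -mulmxZl -mulmxZr -e; mxring.
split=> // x; have [a [v ->]] := dec _ x.
have -> : (a *m u + v *m E) *m Y *m (a *m u + v *m E)^t*
    = a *m (u *m Y *m u^t*) *m a^t* + v *m (E *m Y *m E^t*) *m v^t*.
  rewrite adjD !adjM mulmxDl mulmxDl !mulmxDr.
  have -> : a *m u *m Y *m (E^t* *m v^t*) = 0.
    by rewrite -!mulmxA (mulmxA Y) (mulmxA u) (mulmxA u) uYE !(mul0mx, mulmx0).
  have -> : v *m E *m Y *m (u^t* *m a^t*) = 0.
    by rewrite -!mulmxA (mulmxA Y) (mulmxA E) (mulmxA E) EYu !(mul0mx, mulmx0).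
  by rewrite addr0 add0r !mulmxA.
rewrite mxaddE addr_ge0 ?psdY'.2 //.
rewrite [u *m Y *m _]mx11_scalar -/y mul_mx_scalar mulmxZl mxscaleE mulr_ge0 //.
exact: rV_norm_ge0.
Qed.

(** On the kernel of the nonnegative matrix [Y] the form of [P] vanishes, so [P] annihilates it and
    it is invariant under [A]; an eigenvector in it is excluded by the hypothesis on [P]. *)
Lemma lyapunov_pd n (A Y P : 'M[C]_n) :
  (forall a, eigenvalue A a -> 0 < 'Im a) -> Y^t* = Y -> psd P ->
  (forall a (x : 'rV_n), x *m A = a *: x -> (x *m P *m x^t*) 0 0 = 0 -> x = 0) ->
  A *m Y - Y *m A^t* = 'i *: P -> pd Y.
Proof.
move=> hA hY pP hP e; have pY := lyapunov_psd hA hY pP e.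
have fY : row_free Y.
  apply/negPn/negP => nf.
  have [|mu [x [x0 xY xA]]] := eigenvector_ker (G := A) nf.
    move=> x xY; have := congr1 (mulmx x) e.
    rewrite mulmxBr !mulmxA xY mul0mx subr0 => ->; rewrite mulmxZr.
    rewrite (_ : x *m P = 0) ?scaler0 //; apply: psd_ker => //.
    apply: (mulfI (neq0Ci C)); rewrite mulr0 -mxscaleE -mulmxZl -mulmxZr -e.
    have Yx : Y *m x^t* = 0 by rewrite -hY -adjM xY adj0.
    by rewrite mulmxBr mulmxBl !mulmxA xY -!mulmxA Yx !(mul0mx, mulmx0) subr0 mxE.
  move/eqP: x0; apply; apply: hP xA _.
  have Yx : Y *m x^t* = 0 by rewrite -hY -adjM xY adj0.
  apply: (mulfI (neq0Ci C)); rewrite mulr0 -mxscaleE -mulmxZl -mulmxZr -e.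
  by rewrite mulmxBr mulmxBl !mulmxA xY -!mulmxA Yx !(mul0mx, mulmx0) subr0 mxE.
split=> // x x0; rewrite lt_neqAle pY.2 andbT eq_sym.
apply: contra x0 => /eqP /(psd_ker pY) xY.
by apply/eqP/(row_free_inj fY); rewrite /= mul0mx.
Qed.

End Eigen.

(** * The algebraic Riccati equation *)

Section Controllable.
Context (C : numClosedFieldType).

(** Controllability by annihilators, with no bound on [k], which keeps feedback and similarity free
    of Cayley-Hamilton; [reach_spaceP] relates it to the span. *)
Definition reachable n p (A : 'M[C]_n) (B : 'M_(n, p)) : Prop :=
  forall x : 'rV_n, (forall k, x *m (A ^+ k *m B) = 0) -> x = 0.

Lemma eigen_exp n (A : 'M[C]_n) a (x : 'rV_n) k :
  x *m A = a *: x -> x *m A ^+ k = a ^+ k *: x.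
Proof.
move=> xA; elim: k => [|k IH]; first by rewrite !expr0 mulmx1 scale1r.
by rewrite exprS mulmxA xA mulmxZl IH scalerA -exprS.
Qed.

Lemma eigen_horner n (A : 'M[C]_n.+1) a (x : 'rV_n.+1) (p : {poly C}) :
  x *m A = a *: x -> x *m horner_mx A p = p.[a] *: x.
Proof.
move=> xA; elim/poly_ind: p => [|p c IH].
  by rewrite rmorph0 mulmx0 horner0 scale0r.
rewrite rmorphD rmorphM /= horner_mx_X horner_mx_C mulmxDr mulmxA IH.
by rewrite mulmxZl xA mul_mx_scalar hornerMXaddC scalerA scalerDl.
Qed.

(** The easy half of the Hautus test. *)
Lemma reachable_eigen n p (A : 'M[C]_n) (B : 'M_(n, p)) a (x : 'rV_n) :
  reachable A B -> x *m A = a *: x -> x *m B = 0 -> x = 0.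
Proof.
move=> h xA xB; apply: h => k.
by rewrite mulmxA (eigen_exp k xA) mulmxZl xB scaler0.
Qed.

(** A row annihilating all [(A + B F)^k B] does not see the feedback: its orbits under [A + B F] and
    [A] coincide. *)
Lemma reachable_feedback n p (A : 'M[C]_n) (B : 'M_(n, p)) F :
  reachable A B -> reachable (A + B *m F) B.
Proof.
move=> h x hx; apply: h.
have e k : x *m (A + B *m F) ^+ k = x *m A ^+ k.
  elim: k => [|k IH]; first by rewrite !expr0.
  rewrite !exprSr !mulmxA IH mulmxDr mulmxA -IH -(mulmxA x _ B) hx.
  by rewrite mul0mx addr0.
by move=> k; rewrite mulmxA -e -mulmxA hx.
Qed.

Lemma conj_exp n (T A : 'M[C]_n) k : T \in unitmx ->
  (T *m A *m invmx T) ^+ k = T *m A ^+ k *m invmx T.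
Proof.
move=> uT; elim: k => [|k IH]; first by rewrite !expr0 mulmx1 mulmxV.
by rewrite exprSr IH exprSr -mulmxE !mulmxA mulmxKV.
Qed.

Lemma reachable_conj n p (T A : 'M[C]_n) (B : 'M_(n, p)) : T \in unitmx ->
  reachable A B -> reachable (T *m A *m invmx T) (T *m B).
Proof.
move=> uT h x hx.
suff /(congr1 (mulmx^~ (invmx T))) : x *m T = 0 by rewrite mulmxK // mul0mx.
by apply: h => k; rewrite -(hx k) conj_exp // !mulmxA mulmxKV.
Qed.

End Controllable.

Section Riccati.
Context (C : numClosedFieldType).

Definition riccati n m1 m2 (g : 'M[C]_n) (b : 'M_(n, m2)) (c : 'M_(m1, n)) X :=
  g *m X - X *m g^t* = 'i *: (X *m c^t* *m c *m X - b *m b^t*).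

Lemma gram_eq0 n p (x : 'rV[C]_n) (B : 'M_(n, p)) :
  (x *m (B *m B^t*) *m x^t*) 0 0 = 0 -> x *m B = 0.
Proof. by move=> h; apply: rV_norm_eq0; rewrite -h adjM !mulmxA. Qed.

Lemma im_eigen (a : C) : a - a^* = 'i * (2 * 'Im a).
Proof. by rewrite {1 2}[a]Crect conjC_rect ?Creal_Re ?Creal_Im //; ring. Qed.

Lemma formZ n a (P : 'M[C]_n) (x : 'rV_n) :
  (x *m (a *: P) *m x^t*) 0 0 = a * (x *m P *m x^t*) 0 0.
Proof. by rewrite mulmxZr mulmxZl mxscaleE. Qed.

Lemma form_ker n (A B Y : 'M[C]_n) (x : 'rV_n) : Y^t* = Y -> x *m Y = 0 ->
  (x *m (A *m Y - Y *m B) *m x^t*) 0 0 = 0.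
Proof.
move=> hY xY; have Yx : Y *m x^t* = 0 by rewrite -hY -adjM xY adj0.
by rewrite mulmxBr mulmxBl !mulmxA xY -!mulmxA Yx !(mul0mx, mulmx0) subr0 mxE.
Qed.

Lemma form_eigen n (A X : 'M[C]_n) a (x : 'rV_n) : x *m A = a *: x ->
  (x *m (A *m X - X *m A^t*) *m x^t*) 0 0 =
    'i * (2 * 'Im a) * (x *m X *m x^t*) 0 0.
Proof.
move=> xA; have Ax : A^t* *m x^t* = a^* *: x^t* by rewrite -adjM xA adjZ.
rewrite -im_eigen mulmxBr mulmxBl -!mulmxA Ax !mulmxA xA !mulmxZl !mulmxZr.
by rewrite mxaddE mxoppE !mxscaleE; ring.
Qed.

(* With [|.|_X] the norm of [X], a left eigenvector [y] of the closed loop matrix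
   satisfies [2 Im a |y|_X^2 = - |y X c^t*|^2 - |y b|^2]. *)
Lemma riccati_closed_loop n m1 m2 (g : 'M[C]_n) (b : 'M_(n, m2)) (c : 'M_(m1, n)) X a :
  reachable g b -> pd X -> riccati g b c X ->
  eigenvalue (g - 'i *: (X *m c^t* *m c)) a -> 'Im a < 0.
Proof.
move=> rgb dX eX /eigenvalueP[y yG y0].
set G := g - _ in yG.
have hX := dX.1; have := dX.2 y y0; set q := _ 0 0 => q_gt0.
pose P := X *m c^t* *m (X *m c^t*)^t* + b *m b^t*.
have GX : G *m X - X *m G^t* = - 'i *: P.
  have -> : G *m X - X *m G^t* =
     g *m X - X *m g^t* - 'i *: (2 *: (X *m c^t* *m c *m X)).
    by rewrite /G; adjn; rewrite hX; mxring.
  by rewrite eX /P; adjn; rewrite hX; mxring.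
have key : 'i * (2 * 'Im a) * q = - 'i * (y *m P *m y^t*) 0 0.
  by rewrite -(form_eigen _ yG) GX formZ.
have {}key : 2 * 'Im a * q = - (y *m P *m y^t*) 0 0.
  by apply: (mulfI (neq0Ci C)); rewrite mulrA key; ring.
have p1 := (psd_gram (X *m c^t*)).2 y.
have p2 := (psd_gram b).2 y.
have PE : (y *m P *m y^t*) 0 0 = (y *m (X *m c^t* *m (X *m c^t*)^t*) *m y^t*) 0 0
    + (y *m (b *m b^t*) *m y^t*) 0 0.
  by rewrite -mxaddE /P mulmxDr mulmxDl.
have P_ge0 : 0 <= (y *m P *m y^t*) 0 0 by rewrite PE addr_ge0.
have Ia_le0 : 'Im a <= 0.
  rewrite -(pmulr_lle0 _ q_gt0) -(pmulr_rle0 _ (ltr0Sn C 1)) mulrA key.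
  by rewrite oppr_le0.
rewrite lt_neqAle Ia_le0 andbT; apply: contra y0 => /eqP Ia.
move: key; rewrite Ia mulr0 mul0r => /eqP; rewrite eq_sym oppr_eq0 PE paddr_eq0 //.
case/andP=> /eqP /gram_eq0 yX /eqP /gram_eq0 yb; apply/eqP.
apply: (reachable_eigen (a := a)) rgb _ yb.
by rewrite -yG /G mulmxBr mulmxZr mulmxA yX mul0mx scaler0 subr0.
Qed.

(** The difference [D = X - Y] solves the Sylvester equation [G_X D = D G_Y^t*] between closed loop
    matrices; one spectrum lies below the real axis, the other above. *)
Lemma riccati_unique n m1 m2 (g : 'M[C]_n) (b : 'M_(n, m2)) (c : 'M_(m1, n)) X Y :
  reachable g b -> pd X -> pd Y -> riccati g b c X -> riccati g b c Y -> X = Y.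
Proof.
move=> r dX dY eX eY; apply/eqP; rewrite -subr_eq0; apply/eqP.
pose G X := g - 'i *: (X *m c^t* *m c).
apply: (@sylvester_eq0 _ _ _ (G X) ((G Y)^t*)).
  move=> a /(riccati_closed_loop r dX eX) h1.
  rewrite eigenvalue_adj => /(riccati_closed_loop r dY eY).
  by rewrite Im_conj oppr_lt0 => /(lt_trans h1); rewrite ltxx.
apply/eqP; rewrite -subr_eq0; apply/eqP.
have -> : G X *m (X - Y) - (X - Y) *m (G Y)^t* =
   (g *m X - X *m g^t* - 'i *: (X *m c^t* *m c *m X))
   - (g *m Y - Y *m g^t* - 'i *: (Y *m c^t* *m c *m Y)).
  by rewrite /G; adjn; rewrite dY.1; mxring.
by rewrite eX eY; mxring.
Qed.

Section Existence.
Context (n m1 m2 : nat) (g : 'M[C]_n) (b : 'M[C]_(n, m2)) (c : 'M[C]_(m1, n)).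
Context (rgb : reachable g b) (rgc : reachable (g^t*) (c^t*)).

(* [X] solves the Riccati equation iff the rows of [1 X] span an [H]-invariant
   subspace; [X] is Hermitian iff that subspace is isotropic for [K]. *)
Let H : 'M[C]_(n + n) :=
  block_mx g (- 'i *: (b *m b^t*)) (- 'i *: (c^t* *m c)) (g^t*).
Let K : 'M[C]_(n + n) := block_mx 0 1%:M (- 1%:M) 0.

Lemma ham_sym : H *m K = K *m H^t*.
Proof.
rewrite /H /K adj_block !mulmx_block.
by congr block_mx; adjn; mxring.
Qed.

Lemma ham_rows r (U V : 'M[C]_(r, n)) (G : 'M_r) :
  row_mx U V *m H = G *m row_mx U V ->
  U *m g - 'i *: (V *m c^t* *m c) = G *m U /\
  - 'i *: (U *m b *m b^t*) + V *m g^t* = G *m V.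
Proof.
rewrite /H mul_row_block mul_mx_row => /eq_row_mx[<- <-].
by split; mxring.
Qed.

(** The two halves of the invariance relation combine into a Lyapunov equation for [U V^t*]. Its
    semidefinite right side rules out real eigenvalues of [H] and later gives the positivity of
    [X]. *)
Lemma ham_form r (U V : 'M[C]_(r, n)) (G : 'M_r) :
  row_mx U V *m H = G *m row_mx U V ->
  G *m (U *m V^t*) - U *m V^t* *m G^t* =
    - 'i *: (V *m c^t* *m (V *m c^t*)^t* + U *m b *m (U *m b)^t*).
Proof.
move=> /ham_rows[h1 h2]; rewrite mulmxA -h1.
rewrite -(mulmxA U) -adjM -h2; adjn; mxring.
Qed.

Lemma ham_rows_eigen (U V : 'M[C]_(1, n)) a :
  row_mx U V *m H = a *: row_mx U V ->
  V *m c^t* = 0 -> U *m b = 0 -> row_mx U V = 0.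
Proof.
rewrite -mul_scalar_mx => /ham_rows[]; rewrite !mul_scalar_mx => h1 h2 Vc Ub.
rewrite Vc mul0mx scaler0 subr0 in h1.
rewrite Ub mul0mx scaler0 add0r in h2.
by rewrite (reachable_eigen rgb h1 Ub) (reachable_eigen rgc h2 Vc) row_mx0.
Qed.

Lemma ham_eigen_not_real a : eigenvalue H a -> 'Im a != 0.
Proof.
case/eigenvalueP=> x; rewrite -[x]hsubmxK.
set U := lsubmx x; set V := rsubmx x => xH x0.
have xH' : row_mx U V *m H = a%:M *m row_mx U V by rewrite mul_scalar_mx.
apply: contra x0 => /eqP Ia.
have := ham_form xH'; rewrite adjS mul_scalar_mx mul_mx_scalar -scalerBl.
rewrite im_eigen Ia !mulr0 scale0r => /matrixP /(_ 0 0) /eqP.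
rewrite mxscaleE mxaddE mxzeroE eq_sym mulf_eq0 oppr_eq0 (negPf (neq0Ci C)) /=.
rewrite paddr_eq0 ?rV_norm_ge0 // => /andP[/eqP Vc /eqP Ub].
by rewrite (ham_rows_eigen xH (rV_norm_eq0 Vc) (rV_norm_eq0 Ub)).
Qed.

(** No two eigenvalues of [G] are conjugate, so the Sylvester equation satisfied by [E K E^t*] makes
    it vanish: the subspace is isotropic for the nondegenerate form [K], and its dimension is at
    most half of [n + n]. *)
Lemma ham_isotropic_rank r (E : 'M[C]_(r, n + n)) (G : 'M_r) :
  row_free E -> E *m H = G *m E ->
  (forall a, eigenvalue G a -> eigenvalue G a^* -> False) -> (r <= n)%N.
Proof.
move=> fE EH hG.
have EKE : E *m K *m E^t* = 0.
  apply: (sylvester_eq0 (A := G) (B := G^t*)).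
    by move=> a h; rewrite eigenvalue_adj; apply: hG.
  by rewrite !mulmxA -EH -(mulmxA E) ham_sym -!mulmxA -!adjM EH.
have uK : K \in unitmx.
  have KK : K *m (- K) = 1%:M.
    rewrite mulmxN /K mulmx_block opp_block_mx scalar_mx_block.
    by congr block_mx; mxring.
  by have [] := mulmx1_unit KK.
have := mulmx0_rank_max EKE.
rewrite mxrankMfree ?row_free_unit // mxrank_map mxrank_tr (eqP fE).
by rewrite !addnn leq_double.
Qed.

(** The characteristic polynomial splits into factors with roots below and above the real axis. The
    kernels of the two factors at [H] span the whole space, and each has dimension at most [n] by
    isotropy, so the dimension is exactly [n]. *)
Lemma ham_lower_subspace : exists (E : 'M[C]_(n, n + n)) (G : 'M_n),
  [/\ row_free E, E *m H = G *m E & forall a, eigenvalue G a -> 'Im a < 0].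
Proof.
have [s hs] := closed_field_poly_normal (char_poly H).
rewrite (monicP (char_poly_monic H)) scale1r in hs.
pose p1 := \prod_(z <- s | 'Im z < 0) ('X - z%:P).
pose p2 := \prod_(z <- s | ~~ ('Im z < 0)) ('X - z%:P).
have hp : char_poly H = p1 * p2 by rewrite hs (bigID (fun z => 'Im z < 0)).
have root1 a : root p1 a -> 'Im a < 0.
  rewrite /p1 -big_filter root_prod_XsubC mem_filter; by case/andP.
have root2 a : root p2 a -> 0 < 'Im a.
  move=> h; have : root (char_poly H) a by rewrite hp rootM h orbT.
  rewrite -eigenvalue_root_char => /ham_eigen_not_real Ia.
  move: h; rewrite /p2 -big_filter root_prod_XsubC mem_filter => /andP[+ _].
  by rewrite -real_leNgt ?real0 ?Creal_Im // le_eqVlt eq_sym (negPf Ia).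
have cop : coprimep p1 p2.
  apply: Pdiv.ClosedField.root_coprimep => a /root1 h1; apply/negP => /root2 /(lt_trans h1).
  by rewrite ltxx.
have sub q : exists (r : nat) (E : 'M[C]_(r, n + n)) (G : 'M_r),
    [/\ r = \rank (kermxpoly H q), row_free E, E *m H = G *m E
      & forall a, eigenvalue G a -> root q a].
  have st := comm_mx_stable_kermxpoly q (comm_mx_refl H).
  exists _, (row_base (kermxpoly H q)).
  have /submxP[G hG] : (row_base (kermxpoly H q) *m H <= row_base (kermxpoly H q))%MS.
    by rewrite eq_row_base (eqmxMr H (eq_row_base _)).
  exists G; split=> // [|a /eigenvalueP[v vG v0]]; first exact: row_base_free.
  set E := row_base _ in hG.
  have vE0 : v *m E != 0.
    apply: contra v0 => /eqP vE; apply/eqP/(row_free_inj (row_base_free _)).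
    by rewrite /= mul0mx.
  have vEH : v *m E *m H = a *: (v *m E).
    by rewrite -mulmxA hG mulmxA vG mulmxZl.
  have : (v *m E <= kermxpoly H q)%MS.
    by rewrite (submx_trans (submxMl _ _)) // eq_row_base.
  move: (v *m E) vE0 vEH; clear.
  move: H; rewrite /kermxpoly; case: (n + n)%N => [|k] H' x x0.
    by rewrite thinmx0 eqxx in x0.
  move=> xH /sub_kermxP; rewrite (eigen_horner q xH) => /eqP.
  by rewrite scaler_eq0 (negPf x0) orbF.
have [r1 [E1 [G1 [rk1 f1 e1 h1]]]] := sub p1.
have [r2 [E2 [G2 [rk2 f2 e2 h2]]]] := sub p2.
have le1 : (r1 <= n)%N.
  apply: (ham_isotropic_rank f1 e1) => a /h1/root1 + /h1/root1.
  by rewrite Im_conj oppr_lt0 => /lt_trans h /h; rewrite ltxx.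
have le2 : (r2 <= n)%N.
  apply: (ham_isotropic_rank f2 e2) => a /h2/root2 + /h2/root2.
  by rewrite Im_conj oppr_gt0 => /lt_trans h /h; rewrite ltxx.
have : (n + n <= r1 + r2)%N.
  rewrite rk1 rk2; apply: leq_trans (mxrank_adds_leqif _ _).
  rewrite -(kermxpolyM H cop) -hp; clear.
  move: H; case: (n + n)%N => [|k] H' //.
  rewrite kermxpoly_min ?mxrank1 //; exact: mxminpoly_dvd_char.
move=> ge; have r1n : r1 = n.
  by apply/eqP; rewrite eqn_leq le1 -(leq_add2r n) (leq_trans ge) // leq_add2l.
move: E1 G1 f1 e1 h1 {rk1 le1 ge}; rewrite r1n => E1 G1 f1 e1 h1.
by exists E1, G1; split=> // a /h1/root1.
Qed.

(** Isotropy makes [U V^t*] Hermitian, and the Lyapunov equation for [- G] makes it nonnegative. A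
    kernel of [U] or [V] would contain an eigenvector of [G] on which both Gram terms vanish, which
    the Hautus test excludes. Then [X = U^-1 V] is congruent to the positive definite [U V^t*]. *)
Lemma riccati_exists : exists2 X, pd X & riccati g b c X.
Proof.
have [E [G [fE EH hG]]] := ham_lower_subspace.
move: fE EH; rewrite -[E]hsubmxK; set U := lsubmx E; set V := rsubmx E => fE EH.
have [h1 h2] := ham_rows EH; have W := ham_form EH.
have UV : U *m V^t* = V *m U^t*.
  have EKE : row_mx U V *m K *m (row_mx U V)^t* = 0.
    apply: (sylvester_eq0 (A := G) (B := G^t*)).
      move=> a /hG h; rewrite eigenvalue_adj => /hG.
      by rewrite Im_conj oppr_lt0 => /(lt_trans h); rewrite ltxx.
    by rewrite !mulmxA -EH -(mulmxA (row_mx U V)) ham_sym -!mulmxA -!adjM EH.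
  move/eqP: EKE; rewrite adj_row /K mul_row_block mul_row_col.
  rewrite !(mulmx0, mulmx1, mulmxN, addr0, add0r) mulNmx addrC subr_eq0.
  by move/eqP.
pose P := V *m c^t* *m (V *m c^t*)^t* + U *m b *m (U *m b)^t*.
have pP : psd P by apply: psdD; apply: psd_gram.
have pW : psd (U *m V^t*).
  apply: (@lyapunov_psd _ _ (- G) _ P) => //.
  - by move=> a; rewrite eigenvalue_opp => /hG; rewrite raddfN oppr_lt0.
  - by rewrite adjM trmxCK UV.
  - by rewrite adjN -[RHS]opprK -scaleNr -W mulNmx mulmxN opprB opprK addrC.
have kerP (x : 'rV_n) : x *m (U *m V^t*) = 0 -> x *m V *m c^t* = 0 /\ x *m U *m b = 0.
  move=> xW; have : (x *m P *m x^t*) 0 0 = 0.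
    apply: (mulfI (_ : - 'i != 0 :> C)); first by rewrite oppr_eq0 neq0Ci.
    by rewrite mulr0 -formZ -W form_ker // pW.1.
  rewrite /P mulmxDr mulmxDl mxaddE => /eqP.
  rewrite paddr_eq0 ?(psd_gram _).2 // => /andP[/eqP /gram_eq0 + /eqP /gram_eq0].
  by rewrite !mulmxA.
have inj (x : 'rV_n) : x *m row_mx U V = 0 -> x = 0.
  by move=> h; apply: (row_free_inj fE); rewrite /= mul0mx.
have eigen0 a (x : 'rV_n) : x *m G = a *: x -> x *m (U *m V^t*) = 0 -> x = 0.
  move=> xG /kerP[xV xU]; apply: inj.
  rewrite mul_mx_row; apply: (ham_rows_eigen (a := a)) => //.
  by rewrite -mul_mx_row -mulmxA EH mulmxA xG mulmxZl.
have fU : row_free U.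
  apply/negPn/negP => nf.
  have xW (x : 'rV_n) : x *m U = 0 -> x *m (U *m V^t*) = 0.
    by move=> xU; rewrite mulmxA xU mul0mx.
  have [|mu [x [x0 xU xG]]] := eigenvector_ker (G := G) nf.
    move=> x xU; have [xV _] := kerP _ (xW _ xU).
    by rewrite -mulmxA -h1 mulmxBr mulmxZr !mulmxA xU xV !mul0mx scaler0 subr0.
  by move/eqP: x0; apply; apply: eigen0 xG (xW _ xU).
have fV : row_free V.
  apply/negPn/negP => nf.
  have xW (x : 'rV_n) : x *m V = 0 -> x *m (U *m V^t*) = 0.
    by move=> xV; rewrite UV mulmxA xV mul0mx.
  have [|mu [x [x0 xV xG]]] := eigenvector_ker (G := G) nf.
    move=> x xV; have [_ xU] := kerP _ (xW _ xV).
    by rewrite -mulmxA -h2 mulmxDr mulmxZr !mulmxA xV xU !mul0mx scaler0 addr0.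
  by move/eqP: x0; apply; apply: eigen0 xG (xW _ xV).
have uU : U \in unitmx by rewrite -row_free_unit.
have uV : V \in unitmx by rewrite -row_free_unit.
have dW : pd (U *m V^t*).
  split; first exact: pW.1.
  move=> x x0; rewrite lt_neqAle pW.2 andbT eq_sym.
  apply: contra x0 => /eqP /(psd_ker pW) xW; apply/eqP.
  apply: (row_free_inj (A := U *m V^t*)); last by rewrite /= mul0mx.
  by rewrite row_free_unit unitmx_mul uU adj_unit.
have XE : invmx U *m V = invmx U *m (U *m V^t*) *m (invmx U)^t*.
  rewrite UV adjV mulmxA mulmxK ?adj_unit //.
have dX : pd (invmx U *m V) by rewrite XE; apply: pd_cong; rewrite ?unitmx_inv.
exists (invmx U *m V) => //; have hX := dX.1.
rewrite /riccati.
set X := invmx U *m V in hX *.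
have VE : V = U *m X by rewrite /X mulKVmx.
have e : - 'i *: (b *m b^t*) + X *m g^t* = g *m X - 'i *: (X *m c^t* *m c *m X).
  apply: (can_inj (mulKmx uU)); rewrite mulmxDr.
  have -> : U *m (X *m g^t*) = V *m g^t* by rewrite VE mulmxA.
  have -> : U *m (- 'i *: (b *m b^t*)) = - 'i *: (U *m b *m b^t*) by mxring.
  rewrite h2 {1}VE mulmxA -h1 VE; mxring.
have -> : X *m g^t* = g *m X - 'i *: (X *m c^t* *m c *m X) + 'i *: (b *m b^t*).
  by rewrite -e; mxring.
mxring.
Qed.

End Existence.
End Riccati.

(** * Minimal realizations *)

Section ReachableSpace.
Context (C : numClosedFieldType).

(** The sum in [controllable], which thus unfolds to [row_full (reach_space A B)]. *)
Definition reach_space n p (A : 'M[C]_n) (B : 'M_(n, p)) : 'M_n :=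
  (\sum_(k < n) <<(A ^+ k *m B)^T>>)%MS.

(** Cayley-Hamilton, through the remainder of ['X^k] modulo the characteristic polynomial. *)
Lemma power_span n (A : 'M[C]_n) k :
  exists c : nat -> C, A ^+ k = \sum_(i < n) c i *: A ^+ i.
Proof.
case: n A => [|n] A; first by exists (fun=> 0); rewrite [LHS]thinmx0 [RHS]thinmx0.
set p := 'X^k %% char_poly A; exists (fun i => p`_i).
have sp : (size p <= n.+1)%N.
  by rewrite -ltnS -(size_char_poly A) ltn_modp -size_poly_eq0 size_char_poly.
have -> : A ^+ k = horner_mx A p.
  rewrite -{1}(horner_mx_X A) -rmorphXn /= {1}(divp_eq 'X^k (char_poly A)).
  by rewrite rmorphD rmorphM /= Cayley_Hamilton mulr0 add0r.
rewrite -[in LHS](take_poly_id sp) /take_poly poly_def rmorph_sum /=.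
by apply: eq_bigr => i _; rewrite horner_mxZ rmorphXn /= horner_mx_X.
Qed.

Lemma reach_space_sup n p (A : 'M[C]_n) (B : 'M_(n, p)) k :
  ((A ^+ k *m B)^T <= reach_space A B)%MS.
Proof.
have [c ->] := power_span A k.
rewrite mulmx_suml linear_sum; apply: summx_sub => i _.
rewrite mulmxZl linearZ; apply: scalemx_sub.
by apply: (sumsmx_sup i) => //; rewrite genmxE.
Qed.

Lemma reach_spaceP n p (A : 'M[C]_n) (B : 'M_(n, p)) :
  row_full (reach_space A B) <-> reachable A B.
Proof.
split=> [full x hx|h].
  have : (reach_space A B <= kermx x^T)%MS.
    apply/sumsmx_subP => i _; rewrite genmxE; apply/sub_kermxP.
    by rewrite -trmx_mul hx trmx0.
  move/(submx_trans (submx_full 1%:M full))/sub_kermxP.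
  by rewrite mul1mx => /(congr1 trmx); rewrite trmxK trmx0.
rewrite row_full_unit -unitmx_tr -row_free_unit; apply/inj_row_free => x xV.
have Vx : reach_space A B *m x^T = 0.
  by apply: trmx_inj; rewrite trmx_mul trmxK xV trmx0.
apply: h => k; have /submxP[D hD] := reach_space_sup A B k.
by apply: trmx_inj; rewrite trmx_mul hD -mulmxA Vx mulmx0 trmx0.
Qed.

(* Restriction to the reachable subspace: the columns of [E] are a basis of it. *)
Lemma reach_restrict n p (A : 'M[C]_n) (B : 'M_(n, p)) :
  exists (E : 'M_(n, \rank (reach_space A B))) A' B',
    [/\ A *m E = E *m A', B = E *m B' & row_free E^T].
Proof.
set V := reach_space A B; pose E := (row_base V)^T.
have VE (M : 'M_(p, n)) : (M <= V)%MS -> exists M', M^T = E *m M'.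
  rewrite -(eq_row_base V) => /submxP[D ->]; exists D^T.
  by rewrite trmx_mul.
have [B' hB] : exists B', B = E *m B'.
  rewrite -{1}[B]trmxK; apply: VE.
  by have := reach_space_sup A B 0; rewrite expr0 mul1mx.
have /submxP[A' hA] : (row_base V *m A^T <= row_base V)%MS.
  rewrite eq_row_base (eqmxMr _ (eq_row_base V)).
  rewrite /V sumsmxMr; apply/sumsmx_subP => i _.
  rewrite (eqmxMr _ (genmxE _)) -trmx_mul mulmxA.
  by have := reach_space_sup A B i.+1; rewrite exprS.
exists E, A'^T, B'; split=> //; last by rewrite trmxK row_base_free.
by apply: trmx_inj; rewrite !trmx_mul !trmxK.
Qed.

End ReachableSpace.

(** * State space isomorphism of minimal realizations *)

Section StateSpaceIso.
Context (C : numClosedFieldType).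

(** Any [N >= n] is allowed, so that realizations of different orders can be compared with the same
    number of blocks. *)
Lemma reach_mx_free n p N (A : 'M[C]_n) (B : 'M_(n, p)) : (n <= N)%N ->
  reachable A B -> row_free (\mxrow_(k < N) (A ^+ k *m B)).
Proof.
move=> nN h; apply/inj_row_free => x; rewrite mul_mxrow -mxrow0 => /eq_mxrowP hx.
apply: h => k; have [c ->] := power_span A k.
rewrite mulmx_suml mulmx_sumr big1 // => i _.
by rewrite mulmxZl mulmxZr (hx (widen_ord nN i)) scaler0.
Qed.

Lemma obs_mx_full n q N (A : 'M[C]_n) (c : 'M_(q, n)) : (n <= N)%N ->
  reachable A^T c^T -> row_full (\mxcol_(k < N) (c *m A ^+ k)).
Proof.
move=> nN h; rewrite -[X in row_full X]trmxK.
rewrite /row_full mxrank_tr -/(row_free _) tr_mxcol.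
rewrite (_ : \mxrow_i _ = \mxrow_(k < N) (A^T ^+ k *m c^T)); first exact: reach_mx_free.
apply: eq_mxrow => k; rewrite trmx_mul; congr (_ *m _).
elim: (val k) => [|j IH]; first by rewrite !expr0 trmx1.
by rewrite exprS exprSr trmx_mul IH.
Qed.

(** Equal coefficients [c A^k B] mean equal block Hankel matrices, each the product of an
    observability and a reachability matrix. One-sided inverses of these factors give [T] and [T'];
    equality of the orders is a consequence. *)
Lemma state_space_iso n1 n2 p q
    (A1 : 'M[C]_n1) (B1 : 'M_(n1, p)) (c1 : 'M_(q, n1))
    (A2 : 'M[C]_n2) (B2 : 'M_(n2, p)) (c2 : 'M_(q, n2)) :
  reachable A1 B1 -> reachable A1^T c1^T ->
  reachable A2 B2 -> reachable A2^T c2^T ->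
  (forall k, c1 *m A1 ^+ k *m B1 = c2 *m A2 ^+ k *m B2) ->
  exists (T : 'M_(n2, n1)) (T' : 'M_(n1, n2)),
    [/\ T *m T' = 1%:M, T' *m T = 1%:M, T *m A1 = A2 *m T,
      T *m B1 = B2 & c2 *m T = c1].
Proof.
(* Large enough for both realizations, and positive so that block 0, which carries [B] and [c],
   exists. *)
move=> r1 o1 r2 o2 mk; pose N := (n1 + n2).+1.
have le1 : (n1 <= N)%N by rewrite /N ltnW // ltnS leq_addr.
have le2 : (n2 <= N)%N by rewrite /N ltnW // ltnS leq_addl.
set R1 := \mxrow_(k < N) (A1 ^+ k *m B1); set R2 := \mxrow_(k < N) (A2 ^+ k *m B2).
set O1 := \mxcol_(k < N) (c1 *m A1 ^+ k); set O2 := \mxcol_(k < N) (c2 *m A2 ^+ k).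
have fR1 : row_free R1 by apply: reach_mx_free.
have fR2 : row_free R2 by apply: reach_mx_free.
have fO1 : row_full O1 by apply: obs_mx_full.
have fO2 : row_full O2 by apply: obs_mx_full.
have /row_freeP[R2' hR2] := fR2.
have /row_fullP[O2' hO2] := fO2.
have OR : O1 *m R1 = O2 *m R2.
  rewrite !mul_mxcol_mxrow; apply: eq_mxblock => i j.
  by rewrite !mulmxA -(mulmxA c1) -(mulmxA c2) !mulmxE -!exprD mk.
(* The shifted Hankel matrices, from which [T] intertwines [A1] and [A2]. *)
have OAR : O1 *m A1 *m R1 = O2 *m A2 *m R2.
  rewrite /O1 /O2 (mxcol_mul _ A1) (mxcol_mul _ A2) !mul_mxcol_mxrow; apply: eq_mxblock => i j.
  by have := mk (i.+1 + j)%N; rewrite !exprD !exprSr -!mulmxE !mulmxA.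
pose T := O2' *m O1; pose T' := R1 *m R2'.
have TR : T *m R1 = R2 by rewrite /T -mulmxA OR mulmxA hO2 mul1mx.
have OT : O2 *m T = O1.
  apply: (row_free_inj fR1); rewrite /= -mulmxA TR OR //.
exists T, T'; split.
- by rewrite /T' mulmxA TR hR2.
- apply: (row_full_inj fO1); apply: (row_free_inj fR1).
  rewrite /= mulmx1 mulmxA -(mulmxA _ T) TR /T' mulmxA OR -(mulmxA O2) hR2.
  by rewrite mulmx1.
- apply: (row_free_inj fR1); rewrite /= -[RHS]mulmxA TR.
  have := congr1 (mulmx O2') OAR; rewrite !mulmxA hO2 mul1mx => <-.
  by [].
- move: TR; rewrite mul_mxrow /R2 => /eq_mxrowP/(_ ord0).
  by rewrite /= !expr0 !mul1mx.
- move: OT; rewrite /O2 mxcol_mul /O1 => /eq_mxcolP/(_ ord0).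
  by rewrite /= !expr0 !mulmx1.
Qed.

End StateSpaceIso.

(** * Resolvents and estimates near infinity *)

Section Resolvent.
Context (C : numClosedFieldType).

Definition norm1 m n (M : 'M[C]_(m, n)) : C := \sum_i \sum_j `|M i j|.

Lemma norm1_ge0 m n (M : 'M[C]_(m, n)) : 0 <= norm1 M.
Proof. by apply: sumr_ge0 => i _; apply: sumr_ge0. Qed.

Lemma norm1_entry m n (M : 'M[C]_(m, n)) i j : `|M i j| <= norm1 M.
Proof.
rewrite /norm1 (bigD1 i) //= (bigD1 j) //= -addrA lerDl addr_ge0 ?sumr_ge0 //.
by move=> k _; apply: sumr_ge0.
Qed.

Lemma norm1_le0 m n (M : 'M[C]_(m, n)) : norm1 M <= 0 -> M = 0.
Proof.
move=> h; apply/matrixP=> i j; rewrite mxE; apply/normr0_eq0/le_anti.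
by rewrite normr_ge0 (le_trans (norm1_entry M i j)).
Qed.

Lemma norm1D m n (M N : 'M[C]_(m, n)) : norm1 (M + N) <= norm1 M + norm1 N.
Proof.
rewrite -big_split; apply: ler_sum => i _; rewrite -big_split.
by apply: ler_sum => j _; rewrite mxE ler_normD.
Qed.

Lemma norm1N m n (M : 'M[C]_(m, n)) : norm1 (- M) = norm1 M.
Proof.
by apply: eq_bigr => i _; apply: eq_bigr => j _; rewrite mxE normrN.
Qed.

Lemma norm1Z m n a (M : 'M[C]_(m, n)) : norm1 (a *: M) = `|a| * norm1 M.
Proof.
rewrite mulr_sumr; apply: eq_bigr => i _; rewrite mulr_sumr.
by apply: eq_bigr => j _; rewrite mxE normrM.
Qed.

Lemma norm1M m n p (M : 'M[C]_(m, n)) (N : 'M_(n, p)) :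
  norm1 (M *m N) <= norm1 M * norm1 N.
Proof.
rewrite mulr_suml; apply: ler_sum => i _.
apply: (@le_trans _ _ (\sum_j \sum_k `|M i k| * `|N k j|)).
  apply: ler_sum => j _; rewrite mxE (le_trans (ler_norm_sum _ _ _)) //.
  by apply: ler_sum => k _; rewrite normrM.
rewrite exchange_big mulr_suml; apply: ler_sum => k _.
rewrite -mulr_sumr ler_wpM2l // /norm1 (bigD1 k) //= lerDl.
by apply: sumr_ge0 => l _; apply: sumr_ge0.
Qed.

(** Read off from [z X = B + A X]. Having [X] in place of an inverse lets the case [B = 0] yield
    invertibility. *)
Lemma resolvent_bound m n (A : 'M[C]_n) (X B : 'M_(n, m)) z :
  norm1 A < `|z| -> (z%:M - A) *m X = B -> norm1 X <= norm1 B / (`|z| - norm1 A).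
Proof.
move=> hz e; rewrite ler_pdivlMr ?subr_gt0 // mulrC mulrBl lerBlDr.
have -> : `|z| * norm1 X = norm1 (B + A *m X).
  by rewrite -norm1Z -e mulmxBl mul_scalar_mx subrK.
by rewrite (le_trans (norm1D _ _)) // lerD2l norm1M.
Qed.

Lemma resolvent_unit n (A : 'M[C]_n) z : norm1 A < `|z| -> z%:M - A \in unitmx.
Proof.
move=> hz; rewrite -unitmx_tr -row_free_unit; apply/inj_row_free => x hx.
apply: trmx_inj; rewrite trmx0; apply: norm1_le0.
have /(resolvent_bound hz) : (z%:M - A) *m x^T = 0.
  by apply: trmx_inj; rewrite trmx_mul trmxK hx trmx0.
by rewrite (_ : norm1 0 = 0) ?mul0r // /norm1 big1 // => i _;
   rewrite big1 // => j _; rewrite mxE normr0.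
Qed.

(** [P] holds in a neighbourhood of infinity; this takes the place of limits, which would call for a
    topology on [C]. *)
Definition large (P : C -> Prop) := exists2 r, 0 < r & forall z, r < `|z| -> P z.

Lemma large_and (P Q : C -> Prop) :
  large P -> large Q -> large (fun z => P z /\ Q z).
Proof.
move=> [r r0 hr] [s s0 hs]; exists (r + s); first exact: addr_gt0.
by move=> z hz; split; [apply: hr|apply: hs]; apply: le_lt_trans hz;
  rewrite ?lerDl ?lerDr ltW.
Qed.

Lemma large_imp (P Q : C -> Prop) :
  (forall z, P z -> Q z) -> large P -> large Q.
Proof. by move=> h [r r0 hr]; exists r => // z /hr /h. Qed.

Lemma largeT (P : C -> Prop) : (forall z, P z) -> large P.
Proof. by move=> h; exists 1. Qed.

Lemma large_gt a : 0 <= a -> large (fun z => a < `|z|).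
Proof.
move=> a0; exists (a + 1); first by rewrite ltr_wpDl.
by move=> z; apply: le_lt_trans; rewrite lerDl.
Qed.

Lemma large_resolvent n (A : 'M[C]_n) : large (fun z => z%:M - A \in unitmx).
Proof. by apply: large_imp (large_gt (norm1_ge0 A)) => z /resolvent_unit. Qed.

Lemma resolvent_small m n (A : 'M[C]_n) (B : 'M_(n, m)) eps : 0 < eps ->
  large (fun z => norm1 (invmx (z%:M - A) *m B) < eps).
Proof.
move=> e0.
have h : 0 <= norm1 A + norm1 B / eps.
  by rewrite addr_ge0 ?norm1_ge0 // divr_ge0 ?norm1_ge0 // ltW.
apply: large_imp (large_gt h) => z hz.
have hz' : norm1 A < `|z|.
  by apply: le_lt_trans hz; rewrite lerDl divr_ge0 ?norm1_ge0 // ltW.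
have e : (z%:M - A) *m (invmx (z%:M - A) *m B) = B.
  by rewrite mulKVmx // resolvent_unit.
apply: le_lt_trans (resolvent_bound hz' e) _.
by rewrite ltr_pdivrMr ?subr_gt0 // mulrC -ltr_pdivrMr // ltrBrDl.
Qed.

Lemma large_ex (P : C -> Prop) : large P -> exists z, P z.
Proof.
move=> [r r0 hr]; exists (r + 1); apply: hr.
by rewrite ger0_norm ?addr_ge0 ?(ltW r0) // ltrDl.
Qed.

(** Once [|z|] exceeds the sum of [1 + |a|] over the roots [a], every factor [z - a] has modulus at
    least 1, and the leading coefficient is a lower bound. *)
Lemma poly_large (p : {poly C}) : p != 0 ->
  exists2 m, 0 < m & large (fun z => m <= `|p.[z]|).
Proof.
move=> p0; exists `|lead_coef p|; first by rewrite normr_gt0 lead_coef_eq0.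
have [s hs] := closed_field_poly_normal p.
have h0 : 0 <= \sum_(a <- s) (1 + `|a|).
  by apply: sumr_ge0 => a _; rewrite addr_ge0.
apply: large_imp (large_gt h0) => z; rewrite hs lead_coefZ.
rewrite (monicP (monic_prod_XsubC _ _ _)) mulr1 hornerZ normrM => hz.
rewrite ler_peMr //; elim: s {hs} hz h0 => [|a s IH]; first by rewrite big_nil hornerE normr1.
rewrite !big_cons hornerM normrM => hz _.
have hs : 0 <= \sum_(a <- s) (1 + `|a|).
  by apply: sumr_ge0 => b _; rewrite addr_ge0.
rewrite -[X in X <= _]mulr1 ler_pM //.
  rewrite !hornerE (le_trans _ (lerB_dist _ _)) // lerBrDr.
  by apply/ltW/(le_lt_trans _ hz); rewrite lerDl.
by apply: IH => //; apply: le_lt_trans hz; rewrite lerDr addr_ge0.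
Qed.


(* From [z R = 1 + A R] for the resolvent [R] of [A], vanishing of [c R B] on an
   unbounded set forces [c A R B] to be constant there, hence zero by decay. *)
Lemma markov_eq0 n p q (A : 'M[C]_n) (B : 'M_(n, p)) (c : 'M_(q, n)) (Z : C -> Prop) :
  (forall P, large P -> exists2 z, Z z & P z) ->
  (forall z, Z z -> z%:M - A \in unitmx -> c *m invmx (z%:M - A) *m B = 0) ->
  forall k, c *m A ^+ k *m B = 0.
Proof.
move=> hZ h0; pose g k z := c *m A ^+ k *m invmx (z%:M - A) *m B.
have gS k z : z%:M - A \in unitmx -> z *: g k z = c *m A ^+ k *m B + g k.+1 z.
  move=> u; have e : z *: invmx (z%:M - A) = 1%:M + A *m invmx (z%:M - A).
    by apply/eqP; rewrite -subr_eq -mul_scalar_mx -mulmxBl mulmxV.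
  rewrite /g -mulmxZl -mulmxZr e exprSr -mulmxE; mxring.
have key k : (forall z, Z z -> z%:M - A \in unitmx -> g k z = 0) ->
    c *m A ^+ k *m B = 0.
  move=> gk; apply/norm1_le0/negPn/negP => nz.
  have pos : 0 < norm1 (c *m A ^+ k *m B).
    rewrite lt_neqAle norm1_ge0 andbT eq_sym.
    by apply: contra nz => /eqP ->.
  have b : 0 < norm1 (c *m A ^+ k.+1) + 1 by rewrite ltr_wpDl ?norm1_ge0.
  have [z zZ [u hz]] := hZ _ (large_and (large_resolvent A)
    (resolvent_small A B (divr_gt0 pos b))).
  have := gS k z u; rewrite gk // scaler0 => /esym /eqP.
  rewrite addr_eq0 => /eqP e; have := norm1M (c *m A ^+ k.+1) (invmx (z%:M - A) *m B).
  rewrite mulmxA -/(g k.+1 z) -norm1N -e => le1.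
  suff /(le_lt_trans le1) : norm1 (c *m A ^+ k.+1) * norm1 (invmx (z%:M - A) *m B)
    < norm1 (c *m A ^+ k *m B) by rewrite ltxx.
  rewrite (@le_lt_trans _ _ ((norm1 (c *m A ^+ k.+1) + 1) *
     norm1 (invmx (z%:M - A) *m B))) //.
    by rewrite ler_wpM2r ?norm1_ge0 // lerDl.
  by rewrite mulrC -ltr_pdivlMr.
move=> k; apply: (key k); elim: k => [|k IH] z zZ u.
  by rewrite /g expr0 mulmx1; apply: h0.
by have := gS k z u; rewrite IH // scaler0 (key k IH) add0r => <-.
Qed.

End Resolvent.

(** * Realization of strictly proper rational matrix functions *)

Section Realization.
Context (C : numClosedFieldType).

Definition realizes n p q (A : 'M[C]_n) (B : 'M_(n, p)) (c : 'M_(q, n))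
    (f : C -> 'M_(q, p)) :=
  large (fun z => f z = c *m invmx (z%:M - A) *m B).

Definition realizable n p q (f : C -> 'M[C]_(q, p)) :=
  exists (A : 'M_n) B c, realizes A B c f.

Lemma resolvent_eq n p (A : 'M[C]_n) (B X : 'M_(n, p)) z :
  z%:M - A \in unitmx -> (z%:M - A) *m X = B -> invmx (z%:M - A) *m B = X.
Proof. by move=> u <-; rewrite mulKmx. Qed.

Lemma scalar_block n1 n2 (z : C) A B D E :
  z%:M - block_mx A B D E =
  block_mx (z%:M - A) (- B) (- D) (z%:M - E) :> 'M_(n1 + n2).
Proof. by rewrite scalar_mx_block opp_block_mx add_block_mx !add0r. Qed.

Lemma realizable_add n1 n2 p q (f g : C -> 'M[C]_(q, p)) :
  realizable n1 f -> realizable n2 g ->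
  realizable (n1 + n2) (fun z => f z + g z).
Proof.
move=> [A1 [B1 [c1 h1]]] [A2 [B2 [c2 h2]]].
exists (block_mx A1 0 0 A2), (col_mx B1 B2), (row_mx c1 c2).
apply: large_imp (large_and (large_and h1 h2)
  (large_and (large_resolvent A1) (large_resolvent A2))).
move=> z [[-> ->] [u1 u2]]; rewrite -!mulmxA.
rewrite (@resolvent_eq _ _ _ (col_mx B1 B2)
  (col_mx (invmx (z%:M - A1) *m B1) (invmx (z%:M - A2) *m B2))).
- by rewrite mul_row_col.
- by rewrite scalar_block !oppr0 unitmxE det_ublock unitrM -!unitmxE u1.
- by rewrite scalar_block !oppr0 mul_block_col !mul0mx add0r addr0 !mulKVmx.
Qed.

(** Series connection: the output [c2] of the second system feeds the input [B1] of the first. *)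
Lemma realizable_mul n1 n2 p q r (f : C -> 'M[C]_(q, p)) (g : C -> 'M[C]_(p, r)) :
  realizable n1 f -> realizable n2 g ->
  realizable (n1 + n2) (fun z => f z *m g z).
Proof.
move=> [A1 [B1 [c1 h1]]] [A2 [B2 [c2 h2]]].
exists (block_mx A1 (B1 *m c2) 0 A2), (col_mx 0 B2), (row_mx c1 0).
apply: large_imp (large_and (large_and h1 h2)
  (large_and (large_resolvent A1) (large_resolvent A2))).
move=> z [[-> ->] [u1 u2]]; rewrite -![row_mx _ _ *m _ *m _]mulmxA.
rewrite (@resolvent_eq _ _ _ (col_mx 0 B2)
  (col_mx (invmx (z%:M - A1) *m (B1 *m c2 *m (invmx (z%:M - A2) *m B2)))
     (invmx (z%:M - A2) *m B2))).
- by rewrite mul_row_col mul0mx addr0 !mulmxA.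
- by rewrite scalar_block !oppr0 unitmxE det_ublock unitrM -!unitmxE u1.
- rewrite scalar_block !oppr0 mul_block_col !mul0mx add0r !mulKVmx //.
  by rewrite mulNmx subrr.
Qed.

Lemma realizable_const n p q r s (L : 'M[C]_(s, q)) (M : 'M_(p, r)) f :
  realizable n f -> realizable n (fun z => L *m f z *m M).
Proof.
move=> [A [B [c h]]]; exists A, (B *m M), (L *m c).
by apply: large_imp h => z ->; rewrite !mulmxA.
Qed.

Lemma realizable_ext n p q (f g : C -> 'M[C]_(q, p)) :
  large (fun z => f z = g z) -> realizable n f -> realizable n g.
Proof.
move=> fg [A [B [c h]]]; exists A, B, c.
by apply: large_imp (large_and fg h) => z [<- ->].
Qed.

Lemma realizable_inv (a : C) : realizable 1 (fun z => (z - a)^-1%:M : 'M_1).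
Proof.
exists a%:M, 1%:M, 1%:M; apply: largeT => z.
by rewrite mul1mx mulmx1 -raddfB invmx_scalar.
Qed.

Lemma large_prod_neq0 (s : seq C) :
  large (fun z => (\prod_(a <- s) ('X - a%:P)).[z] != 0).
Proof.
have [m m0] := poly_large (monic_neq0 (monic_prod_XsubC s predT id)).
by apply: large_imp => z hz; rewrite -normr_gt0 (lt_le_trans m0).
Qed.

(** With [Q] the product over the remaining roots and [p = k Q + r], [k] constant, the fraction is
    [(z - a)^-1 (k + r / Q)]: a sum and a series connection. The size bound is strict properness. *)
Lemma realizable_frac (s : seq C) (p : {poly C}) : (size p <= size s)%N ->
  exists n, realizable n
    (fun z => (p.[z] / (\prod_(a <- s) ('X - a%:P)).[z])%:M : 'M_1).
Proof.
elim: s p => [|a s IH] p.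
  rewrite size_poly_leq0 => /eqP ->; exists 0%N; exists 0, 0, 0.
  by apply: largeT => z; rewrite horner0 mul0r mulmx0 raddf0.
move=> sp; set Q := \prod_(b <- s) ('X - b%:P).
have Qm : Q \is monic := monic_prod_XsubC s predT id.
have sQ : size Q = (size s).+1 by rewrite size_prod_XsubC.
have sd : (size (p %/ Q)%R <= 1)%N.
  rewrite size_divp ?monic_neq0 // sQ /=.
  by move: sp; rewrite /= -addn1 leq_subLR addnC.
have [n hn] : exists n, realizable n (fun z => ((p %% Q).[z] / Q.[z])%:M : 'M_1).
  by apply: IH; rewrite -ltnS -sQ ltn_modp monic_neq0.
set k := (p %/ Q)`_0.
have h1 := realizable_const (k%:M : 'M_1) (1%:M : 'M_1) (realizable_inv a).
have h2 := realizable_mul (realizable_inv a) hn.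
exists (1 + (1 + n))%N.
apply: realizable_ext (realizable_add h1 h2).
apply: large_imp (large_prod_neq0 (a :: s)) => z.
rewrite big_cons hornerM hornerXsubC -/Q mulf_eq0 negb_or => /andP[za Qz].
rewrite mulmx1 -!scalar_mxM -raddfD; congr (_%:M).
rewrite {2}(divp_eq p Q) (size1_polyC sd) -/k.
rewrite hornerD hornerM hornerC.
by field; rewrite za Qz.
Qed.

Lemma realizable0 p q : realizable 0 (fun=> 0 : 'M[C]_(q, p)).
Proof. by exists 0, 0, 0; apply: largeT => z; rewrite mulmx0. Qed.

Lemma realizable_sum (I : Type) (s : seq I) p q (F : I -> C -> 'M[C]_(q, p)) :
  (forall i, exists n, realizable n (F i)) ->
  exists n, realizable n (fun z => \sum_(i <- s) F i z).
Proof.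
move=> h; elim: s => [|i s [n hn]].
  exists 0%N; apply: realizable_ext (realizable0 p q).
  by apply: largeT => z; rewrite big_nil.
have [k hk] := h i; exists (k + n)%N.
apply: realizable_ext (realizable_add hk hn).
by apply: largeT => z; rewrite big_cons.
Qed.

Lemma realizable_rat (p q : {poly C}) : (size p < size q)%N ->
  exists n, realizable n (fun z => (p.[z] / q.[z])%:M : 'M_1).
Proof.
have [s hs] := closed_field_poly_normal q.
move=> pq; have q0 : q != 0 by apply: contraTneq pq => ->; rewrite size_poly0.
have l0 : lead_coef q != 0 by rewrite lead_coef_eq0.
have sp : (size ((lead_coef q)^-1 *: p) <= size s)%N.
  rewrite size_scale ?invr_eq0 // -ltnS (leq_trans pq) //.
  by rewrite hs size_scale // size_prod_XsubC.
have [n hn] := realizable_frac sp; exists n.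
apply: realizable_ext hn; apply: largeT => z; congr (_%:M).
rewrite [in RHS]hs !hornerZ invfM; ring.
Qed.

(* [u = p %/ q] is the difference of [p/q] and a strictly proper function. *)
Lemma small_frac (p q : {poly C}) : q != 0 ->
  (forall eps, 0 < eps -> large (fun z => `|p.[z] / q.[z]| < eps)) ->
  (size p < size q)%N.
Proof.
move=> q0 small; have [n [A [B [c h]]]] := realizable_rat (ltn_modpN0 p q0).
have [u0|u0] := eqVneq (p %/ q) 0.
  by rewrite [p](divp_eq p q) u0 mul0r add0r ltn_modp.
have [m m0 lm] := poly_large u0.
have m2 : 0 < m / 2 by rewrite divr_gt0.
have b : 0 < norm1 c + 1 by rewrite ltr_wpDl ?norm1_ge0.
have [l l0 lq] := poly_large q0.
have [z [[hz1 hz2] [[hz3 hz4] hz5]]] := large_ex (large_and (large_and lm (small _ m2))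
  (large_and (large_and h (resolvent_small A B (divr_gt0 m2 b))) lq)).
have qz : q.[z] != 0 by rewrite -normr_gt0 (lt_le_trans l0).
have e : p.[z] / q.[z] = (p %/ q).[z] + (p %% q).[z] / q.[z].
  by rewrite {1}(divp_eq p q) hornerD hornerM mulrDl mulfK.
have small_r : `|(p %% q).[z] / q.[z]| < m / 2.
  have := norm1_entry (((p %% q).[z] / q.[z])%:M : 'M_1) 0 0.
  rewrite mxE eqxx mulr1n => /le_lt_trans -> //.
  rewrite hz3 -mulmxA (le_lt_trans (norm1M _ _)) //.
  rewrite (@le_lt_trans _ _ ((norm1 c + 1) * norm1 (invmx (z%:M - A) *m B))) //.
    by rewrite ler_wpM2r ?norm1_ge0 // lerDl.
  by rewrite mulrC -ltr_pdivlMr.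
have : `|(p %/ q).[z]| < m.
  rewrite (_ : (p %/ q).[z] = p.[z] / q.[z] - (p %% q).[z] / q.[z]).
    by rewrite (le_lt_trans (ler_normB _ _)) // [m]splitr ltrD.
  by rewrite e addrK.
by move=> /(le_lt_trans hz1); rewrite ltxx.
Qed.

Lemma realizable_mx p q (f : C -> 'M[C]_(q, p)) :
  (forall i j, exists n, realizable n (fun z => (f z i j)%:M : 'M_1)) ->
  exists n, realizable n f.
Proof.
move=> h.
have [ij|n hn] := @realizable_sum _ (index_enum ('I_q * 'I_p)%type) p q
  (fun ij z => delta_mx ij.1 0 *m (f z ij.1 ij.2)%:M *m (delta_mx 0 ij.2 : 'rV_p)).
  by have [n hn] := h ij.1 ij.2; exists n; apply: realizable_const.
exists n; apply: realizable_ext hn; apply: largeT => z.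
rewrite [RHS]matrix_sum_delta pair_big /=; apply: eq_bigr => ij _.
by rewrite mul_mx_scalar mulmxZl mul_delta_mx.
Qed.

Lemma realizes_restrict n r p q (A : 'M[C]_n) (B : 'M_(n, p)) (c : 'M_(q, n)) f
    (E : 'M_(n, r)) A' B' :
  A *m E = E *m A' -> B = E *m B' -> realizes A B c f ->
  realizes A' B' (c *m E) f.
Proof.
move=> AE BE h; apply: large_imp (large_and h
  (large_and (large_resolvent A) (large_resolvent A'))) => z [-> [u u']].
rewrite -!mulmxA; congr (_ *m _); apply: resolvent_eq => //.
have e : (z%:M - A) *m E = E *m (z%:M - A').
  by rewrite mulmxBl mulmxBr AE mul_scalar_mx mul_mx_scalar.
rewrite (mulmxA _ E) e -(mulmxA E) mulKVmx //.
Qed.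

Lemma realizes_tr n p q (A : 'M[C]_n) (B : 'M_(n, p)) (c : 'M_(q, n)) f :
  realizes A B c f -> realizes A^T c^T B^T (fun z => (f z)^T).
Proof.
apply: large_imp => z ->; rewrite !trmx_mul trmx_inv linearB /= tr_scalar_mx.
by rewrite mulmxA.
Qed.

(** Restriction to the reachable space lowers the order unless the pair is controllable;
    observability is the same argument on the transposed realization. *)
Lemma minimal_realization n p q (f : C -> 'M[C]_(q, p)) : realizable n f ->
  exists (k : nat) (A : 'M[C]_k) (B : 'M_(k, p)) (c : 'M_(q, k)),
    [/\ realizes A B c f, reachable A B & reachable A^T c^T].
Proof.
elim/ltn_ind: n => n IH [A [B [c h]]].
have [full1|nfull] := boolP (row_full (reach_space A B)); last first.
  have [E [A' [B' [AE BE _]]]] := reach_restrict A B.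
  apply: (IH (\rank (reach_space A B))).
    by rewrite ltn_neqAle rank_leq_col andbT.
  by exists A', B', (c *m E); apply: realizes_restrict h.
have [full2|nfull] := boolP (row_full (reach_space A^T c^T)); last first.
  have [E [A' [B' [AE BE _]]]] := reach_restrict A^T c^T.
  apply: (IH (\rank (reach_space A^T c^T))).
    by rewrite ltn_neqAle rank_leq_col andbT.
  have /realizes_tr hr := realizes_restrict AE BE (realizes_tr h).
  exists A'^T, (B^T *m E)^T, B'^T.
  by apply: large_imp hr => z; rewrite trmxK.
by exists n, A, B, c; split=> //; apply/reach_spaceP.
Qed.

Lemma rational_realization p q (f : C -> 'M[C]_(q, p)) :
  (forall i j, exists u v : {poly C}, v != 0 /\
     forall z, v.[z] != 0 -> f z i j = u.[z] / v.[z]) ->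
  (forall eps, 0 < eps -> large (fun z => forall i j, `|f z i j| < eps)) ->
  exists (k : nat) (A : 'M[C]_k) (B : 'M_(k, p)) (c : 'M_(q, k)),
    [/\ realizes A B c f, reachable A B & reachable A^T c^T].
Proof.
move=> rat small; have [n hn] : exists n, realizable n f.
  apply: realizable_mx => i j; have [u [v [v0 hv]]] := rat i j.
  have [m m0 lm] := poly_large v0.
  have fE : large (fun z => u.[z] / v.[z] = f z i j).
    by apply: large_imp lm => z hz; rewrite hv // -normr_gt0 (lt_le_trans m0).
  have [|n hn] := @realizable_rat u v.
    apply: small_frac => // eps /small h.
    by apply: large_imp (large_and fE h) => z [-> /(_ i j)].
  exists n; apply: realizable_ext hn.
  by apply: large_imp fE => z ->.
exact: minimal_realization hn.
Qed.

End Realization.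

(** * Darboux matrices *)

Section Node.
Context (C : numClosedFieldType).

(** The operator identity of an S-node. Positivity of [S] is kept apart, since the algebra of one
    step rests on invertibility. *)
Definition node n m (a S : 'M[C]_n) (L : 'M_(n, m)) : Prop :=
  S^t* = S /\ a *m S - S *m a^t* = 'i *: (L *m L^t*).

(* The transfer matrix function of the node at the point [- z]; with [S = S_k] and
   [L = Lambda_k] it is the Darboux matrix of the system. *)
Definition transfer n m (a S : 'M[C]_n) (L : 'M_(n, m)) (z : C) : 'M_m :=
  1%:M - 'i *: (L^t* *m invmx S *m (invmx (a + z%:M) *m L)).

(** The node identity turns [L L^t*] into a difference of resolvent terms. At [zeta = z^*] the
    correction vanishes, which gives invertibility, and unitarity at real points; at [zeta = z], for
    positive [S], it is [- 2 Im z] times a nonnegative matrix. *)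
Lemma transfer_gram n m (a S : 'M[C]_n) (L : 'M_(n, m)) z zeta :
  node a S L -> S \in unitmx ->
  a + z%:M \in unitmx -> a + zeta%:M \in unitmx ->
  (transfer a S L zeta)^t* *m transfer a S L z =
  1%:M + ('i * (z - zeta^*)) *:
    ((invmx (a + zeta%:M) *m L)^t* *m invmx S *m (invmx (a + z%:M) *m L)).
Proof.
move=> [hS e] uS uz uzeta; rewrite /transfer.
set y := invmx (a + z%:M) *m L; set x := invmx (a + zeta%:M) *m L.
set T := invmx S.
have Ly : L = a *m y + z *: y by rewrite -mul_scalar_mx -mulmxDl mulKVmx.
have Lx : L = a *m x + zeta *: x by rewrite -mul_scalar_mx -mulmxDl mulKVmx.
have hT : T^t* = T by rewrite adjV hS.
have TKS p (M : 'M[C]_(p, n)) : M *m T *m S = M by rewrite mulmxKV.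
have SKT p (M : 'M[C]_(p, n)) : M *m S *m T = M by rewrite mulmxK.
clearbody x y T.
have Lx' : L^t* = x^t* *m a^t* + zeta^* *: x^t* by rewrite {1}Lx adjD adjM adjZ.
have LL : x^t* *m T *m L *m L^t* *m T *m y =
    - 'i *: (x^t* *m T *m a *m y - x^t* *m a^t* *m T *m y).
  have -> : x^t* *m T *m L *m L^t* *m T *m y = - 'i *: (x^t* *m T *m ('i *: (L *m L^t*)) *m T *m y).
    mxringi C.
  rewrite -e mulmxBr !mulmxBl !mulmxA; congr (_ *: (_ - _)).
    by rewrite SKT.
  by rewrite TKS.
have -> : (1%:M - 'i *: (L^t* *m T *m x))^t* *m (1%:M - 'i *: (L^t* *m T *m y)) =
   1%:M - 'i *: (L^t* *m T *m y) + 'i *: (x^t* *m T *m L)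
     + x^t* *m T *m L *m L^t* *m T *m y.
  by adjn; rewrite hT; mxringi C.
by rewrite LL Lx' {1}Ly; mxringi C.
Qed.

Section Step.
Context (n m : nat) (a S : 'M[C]_n) (L : 'M[C]_(n, m)) (j : 'M[C]_m).
Context (ua : a \in unitmx) (hN : node a S L) (uS : S \in unitmx).
Context (hj : j^t* = j) (jj : j *m j = 1%:M).

Definition next_L : 'M_(n, m) := L + 'i *: (invmx a *m L *m j).
Definition next_S : 'M_n := S + invmx a *m S *m invmx (a^t*)
  + invmx a *m L *m j *m L^t* *m invmx (a^t*).
Definition step_pot : 'M_m :=
  j + L^t* *m invmx S *m L - next_L^t* *m invmx next_S *m next_L.

Lemma next_node : node a next_S next_L.
Proof.
have [hS e] := hN; have ua' : a^t* \in unitmx by rewrite adj_unit.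
split; first by rewrite /next_S; adjn; rewrite hS hj !mulmxA.
have e2 : S *m invmx (a^t*) - invmx a *m S =
    'i *: (invmx a *m L *m L^t* *m invmx (a^t*)).
  have -> : 'i *: (invmx a *m L *m L^t* *m invmx (a^t*)) =
     invmx a *m ('i *: (L *m L^t*)) *m invmx (a^t*) by mxring.
  by rewrite -e mulmxBr mulmxBl !mulmxA mulVmx // mul1mx mulmxK.
rewrite /next_S /next_L; adjn; rewrite hj.
mxnorm; rewrite mulmxV // !mul1mx !mulmxKV //.
have jjr p q (M : 'M[C]_(p, m)) (N : 'M_(m, q)) : M *m j *m j *m N = M *m N.
  by rewrite -(mulmxA M) jj mulmx1.
rewrite ?(jjr _ _ (invmx a *m L)).
have -> : a *m S = S *m a^t* + 'i *: (L *m L^t*) by rewrite -e addrC subrK.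
have -> : S *m invmx (a^t*) = invmx a *m S + 'i *: (invmx a *m L *m L^t* *m invmx (a^t*)).
  by rewrite -e2 addrC subrK.
mxringi C.
Qed.

Context (uS' : next_S \in unitmx).

Lemma step_pot_herm : step_pot^t* = step_pot.
Proof.
have herm p (T : 'M[C]_p) (M : 'M_(p, m)) : T^t* = T ->
    (M^t* *m invmx T *m M)^t* = M^t* *m invmx T *m M.
  by move=> hT; adjn; rewrite hT mulmxA.
by rewrite /step_pot adjD adjN adjD hj !herm // ?next_node.1 ?hN.1.
Qed.

(** The content of [transfer_step] that is free of [z]. It is checked after right multiplication by
    [S], where [N] expresses [next_S *m a^t*] through [S]. *)
Lemma step_pot_intertwine :
  step_pot *m (L^t* *m invmx S) =
  'i *: (next_L^t* *m invmx next_S *m (a + invmx a)) - 'i *: (L^t* *m invmx S *m a).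
Proof.
have [hS e] := hN; have ua' : a^t* \in unitmx by rewrite adj_unit.
apply: (can_inj (mulmxK uS)).
set X := L^t* *m invmx S; set X' := next_L^t* *m invmx next_S.
have XS : X *m S = L^t* by rewrite /X mulmxKV.
have XS' : X' *m next_S = next_L^t* by rewrite /X' mulmxKV.
have N : next_S *m a^t* = (a + invmx a) *m S - 'i *: (next_L *m L^t*).
  rewrite /next_S /next_L; mxnorm; rewrite !mulmxKV //.
  have -> : a *m S = S *m a^t* + 'i *: (L *m L^t*) by rewrite -e addrC subrK.
  mxringi C.
have LL : X *m L *m L^t* = - 'i *: (X *m a *m S - L^t* *m a^t*).
  have -> : X *m L *m L^t* = - 'i *: (X *m ('i *: (L *m L^t*))) by mxringi C.
  by rewrite -e mulmxBr !mulmxA XS.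
have Lj : j *m L^t* + 'i *: (L^t* *m a^t*) = 'i *: (X' *m next_S *m a^t*).
  rewrite XS' /next_L; adjn; rewrite hj; mxnorm; rewrite mulmxKV //; mxringi C.
rewrite -(mulmxA _ X) XS /step_pot -/X -/X' mulmxBl mulmxDl LL.
have -> : j *m L^t* = 'i *: (X' *m next_S *m a^t*) - 'i *: (L^t* *m a^t*).
  by rewrite -Lj addrK.
rewrite -(mulmxA X') N; mxringi C.
Qed.

Lemma transfer_step z : z != 0 -> a + z%:M \in unitmx ->
  transfer a next_S next_L z *m (1%:M + ('i / z) *: j) =
  (1%:M + ('i / z) *: step_pot) *m transfer a S L z.
Proof.
move=> z0 uz; rewrite /transfer; have K := step_pot_intertwine.
set y := invmx (a + z%:M) *m L.
have Ly : L = a *m y + z *: y by rewrite -mul_scalar_mx -mulmxDl mulKVmx.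
(* Expressing the resolvent at [next_L] through [y] leaves [y] as the only resolvent term. *)
have rb : invmx (a + z%:M) *m next_L = y + ('i / z) *: (invmx a *m L *m j - y *m j).
  have -> : invmx a *m L *m j - y *m j = z *: (invmx a *m y *m j).
    by rewrite {1}Ly; mxnorm; rewrite mulVmx // mul1mx; mxring.
  apply: (can_inj (mulKmx uz)).
  rewrite mulKVmx // /next_L {1}Ly {1}Ly; mxnorm; rewrite mulVmx // mulmxV // !mul1mx.
  by mxent; field.
clearbody y.
have dist (D : 'M[C]_m) (X : 'M_(m, n)) :
    (1%:M + ('i / z) *: D) *m (1%:M - 'i *: (X *m y)) =
    1%:M + ('i / z) *: D - 'i *: (X *m y) + z^-1 *: (D *m X *m y).
  mxringi C.
rewrite dist {dist} K rb /step_pot.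
set X := L^t* *m invmx S; set X' := next_L^t* *m invmx next_S.
clearbody X X'; rewrite /next_L.
have jjr p (M : 'M[C]_(p, m)) : M *m j *m j = M by rewrite -mulmxA jj mulmx1.
rewrite Ly; mxnorm; rewrite !jjr !mulmxKV //.
by mxent; field: (sqrCi C).
Qed.

End Step.
End Node.

(** * Unitary similarity of the potentials to [j] *)

Section Signature.
Context (C : numClosedFieldType).

(** By cyclicity the trace depends on [a] alone; it is the same at every step, so the potential has
    the trace of [j]. *)
Lemma node_trace n m (a S : 'M[C]_n) (L : 'M_(n, m)) : node a S L -> S \in unitmx ->
  \tr (L^t* *m invmx S *m L) = - 'i * (\tr a - \tr (a^t*)).
Proof.
move=> [_ e] uS; rewrite mxtrace_mulC mulmxA.
have -> : L *m L^t* = - 'i *: (a *m S - S *m a^t*).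
  by rewrite e; mxringi C.
rewrite mulmxZl linearZ /= mulmxBl linearB /= mulmxK //; congr (_ * (_ - _)).
by rewrite -mulmxA mxtrace_mulC mulmxKV.
Qed.

(* At [z = 1] both transfer matrices are unitary, so [1 + i C] is a unitary
   conjugate, on both sides, of [1 + i j]. *)
Lemma step_pot_sq n m (a S : 'M[C]_n) (L : 'M_(n, m)) (j : 'M_m) :
  a \in unitmx -> a + 1%:M \in unitmx -> node a S L -> S \in unitmx ->
  j^t* = j -> j *m j = 1%:M -> next_S a S L j \in unitmx ->
  step_pot a S L j *m step_pot a S L j = 1%:M.
Proof.
move=> ua u1 hN uS hj jj uS'; have hN' := next_node ua hN hj jj.
have hD := step_pot_herm ua hN hj jj.
have := transfer_step ua hN uS hj jj uS' (oner_neq0 C) u1.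
have := transfer_gram hN uS u1 u1; have := transfer_gram hN' uS' u1 u1.
rewrite conjC1 subrr mulr0 !scale0r !addr0 divr1.
move: (transfer _ _ L 1) (transfer _ _ _ 1) hD.
move: (step_pot a S L j) => D w w' hD g' g e.
have gr : w' *m w'^t* = 1%:M by rewrite mulmx1C.
have gr2 : w *m w^t* = 1%:M by rewrite mulmx1C.
have : (1%:M + 'i *: D) *m w *m ((1%:M + 'i *: D) *m w)^t* = 2%:R *: 1%:M.
  rewrite -e adjM mulmxA -(mulmxA w') adjD adjZ adj1 hj conj_i.
  have -> : (1%:M + 'i *: j) *m (1%:M + - 'i *: j) = 2%:R *: 1%:M.
    have -> : (1%:M + 'i *: j) *m (1%:M + - 'i *: j) = 1%:M + j *m j by mxringi C.
    by rewrite jj; mxring.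
  by rewrite mulmxZr mulmx1 mulmxZl gr.
rewrite adjM mulmxA -(mulmxA _ w) gr2 mulmx1 adjD adjZ adj1 hD conj_i.
have -> : (1%:M + 'i *: D) *m (1%:M + - 'i *: D) = 1%:M + D *m D by mxringi C.
by move=> h; apply: (addrI 1%:M); rewrite h; mxring.
Qed.

Lemma rank_idempotent n (P : 'M[C]_n) : P *m P = P -> (\rank P)%:R = \tr P.
Proof.
move=> PP; rewrite -{2}(mulmx_base P) mxtrace_mulC.
have -> : row_base P *m col_base P = 1%:M; last by rewrite mxtrace1.
have fR := row_base_free P; have fL := col_base_full P.
apply: (row_full_inj fL); apply: (row_free_inj fR) => /=.
by rewrite mulmx1 mulmxA mulmx_base -mulmxA mulmx_base PP.
Qed.

Lemma idempotent_rows n (P : 'M[C]_n) : P *m P = P ->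
  exists2 U : 'M_(\rank P, n), U \is unitarymx & U *m P = U.
Proof.
move=> PP; exists (schmidt (row_base P)).
  by rewrite schmidt_unitarymx // rank_leq_row.
have : (schmidt (row_base P) <= P)%MS.
  by rewrite (eqmx_schmidt_free (row_base_free P)) eq_row_base.
by case/submxP=> D ->; rewrite -mulmxA PP.
Qed.

(** [(1 + D) / 2] and [(1 - D) / 2] are the spectral projections of [D]; the trace fixes their ranks
    as [m1] and [m2], and orthonormal bases of their row spaces form [U]. *)
Lemma signature_unitary m1 m2 (D : 'M[C]_(m1 + m2)) :
  let j := block_mx 1%:M 0 0 (- 1%:M) in
  D^t* = D -> D *m D = 1%:M -> \tr D = \tr j ->
  exists2 U : 'M_(m1 + m2), U \is unitarymx & D = U^t* *m j *m U.
Proof.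
move=> j hD DD trD.
have trj : \tr D = m1%:R - m2%:R.
  by rewrite trD mxtrace_block linearN /= !mxtrace1.
have two : 2%:R != 0 :> C by rewrite pnatr_eq0.
pose P := 2^-1 *: (1%:M + D); pose Q := 2^-1 *: (1%:M - D).
have PP : P *m P = P.
  have -> : P *m P = 4^-1 *: (1%:M + 2 *: D + D *m D) by rewrite /P; mxnorm; mxent; field.
  by rewrite DD /P; mxent; field.
have QQ : Q *m Q = Q.
  have -> : Q *m Q = 4^-1 *: (1%:M - 2 *: D + D *m D) by rewrite /Q; mxnorm; mxent; field.
  by rewrite DD /Q; mxent; field.
have rP : \rank P = m1.
  apply/eqP; rewrite -(eqr_nat C) rank_idempotent // /P linearZ linearD /=.
  by rewrite mxtrace1 trj natrD; apply/eqP; field.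
have rQ : \rank Q = m2.
  apply/eqP; rewrite -(eqr_nat C) rank_idempotent // /Q linearZ linearB /=.
  by rewrite mxtrace1 trj natrD; apply/eqP; field.
have [U1] := idempotent_rows PP; have [U2] := idempotent_rows QQ.
move: U1 U2; rewrite rP rQ => U1 U2 uU2 U2Q uU1 U1P.
have U1D : U1 *m D = U1.
  have -> : D = 2 *: P - 1%:M by rewrite /P; mxent; field.
  by rewrite mulmxBr mulmxZr U1P mulmx1; mxring.
have U2D : U2 *m D = - U2.
  have -> : D = 1%:M - 2 *: Q by rewrite /Q; mxent; field.
  by rewrite mulmxBr mulmxZr U2Q mulmx1; mxring.
have U12 : U1 *m U2^t* = 0.
  have : U1 *m U2^t* = - (U1 *m U2^t*).
    by rewrite -{1}U1D -mulmxA -{1}hD -adjM U2D adjN mulmxN.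
  move/eqP; rewrite -addr_eq0 -mulr2n -scaler_nat scaler_eq0 (negPf two) /=.
  by move/eqP.
have U21 : U2 *m U1^t* = 0.
  by apply: adj_inj; rewrite adjM trmxCK U12 adj0.
pose U : 'M[C]_(m1 + m2) := col_mx U1 U2.
have uU : U \is unitarymx.
  apply/unitarymxP; rewrite /U adj_col mul_col_row U12 U21.
  by rewrite (unitarymxP uU1) (unitarymxP uU2) -scalar_mx_block.
exists U => //; have UU : U^t* *m U = 1%:M by apply: mulmx1C; apply/unitarymxP.
have -> : U^t* *m j *m U = U^t* *m (U *m D).
  rewrite -mulmxA /j /U mul_block_col mul_col_mx U1D U2D.
  by rewrite !mul1mx !mul0mx addr0 add0r mulNmx mul1mx.
by rewrite mulmxA UU mul1mx.
Qed.

End Signature.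

(** * Order on Hermitian matrices and bounds for transfer functions *)

Section PsdOrder.
Context (C : numClosedFieldType).

Lemma psd_cong m n (T : 'M[C]_(m, n)) P : psd P -> psd (T *m P *m T^t*).
Proof.
move=> [hP pP]; split; first by rewrite !adjM trmxCK hP mulmxA.
by move=> x; have := pP (x *m T); rewrite adjM !mulmxA.
Qed.

Lemma invmx_mul n (A B : 'M[C]_n) : A \in unitmx -> B \in unitmx ->
  invmx (A *m B) = invmx B *m invmx A.
Proof.
move=> uA uB; have uAB : A *m B \in unitmx by rewrite unitmx_mul uA.
apply: (can_inj (mulKmx uAB)); rewrite mulmxV //.
by rewrite mulmxA -(mulmxA A) mulmxV // mulmx1 mulmxV.
Qed.

Lemma psd_diag m n (P : 'M[C]_m) (Y : 'M_(m, n)) i :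
  psd P -> 0 <= (Y^t* *m P *m Y) i i.
Proof.
move=> [_ pP]; have := pP (row i (Y^t*)).
rewrite -row_mul; congr (_ <= _); rewrite !mxE.
by apply: eq_bigr => k _; rewrite !mxE conjCK.
Qed.

(** The difference of the inverses is a congruence of [B] plus a congruence of [S - B], which avoids
    square roots. *)
Lemma psd_inv_anti n (S B : 'M[C]_n) :
  pd S -> pd B -> psd (S - B) -> psd (invmx B - invmx S).
Proof.
move=> dS dB hSB; have uS := pd_unit dS; have uB := pd_unit dB.
have hS : (invmx S)^t* = invmx S := (pd_inv dS).1.
have hB : (invmx B)^t* = invmx B := (pd_inv dB).1.
have -> : invmx B - invmx S =
    (invmx B - invmx S) *m B *m (invmx B - invmx S)^t*
    + invmx S *m (S - B) *m (invmx S)^t*.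
  rewrite adjD adjN hS hB; mxnorm.
  rewrite !mulVmx // !mul1mx mulmxK //.
  by mxent; ring.
by apply: psdD; apply: psd_cong => //; apply: pd_psd.
Qed.

Lemma transfer_contractive n m p (a S : 'M[C]_n) (L : 'M_(n, m)) z (Y : 'M_(m, p)) i :
  node a S L -> pd S -> a + z%:M \in unitmx -> 0 <= 'Im z ->
  ((transfer a S L z *m Y)^t* *m (transfer a S L z *m Y)) i i <= (Y^t* *m Y) i i.
Proof.
move=> hN dS uz z0; rewrite adjM mulmxA -(mulmxA _ _ (transfer _ _ _ _)).
rewrite (transfer_gram hN (pd_unit dS) uz uz) im_eigen.
set y := invmx _ *m L.
have -> : 'i * ('i * (2 * 'Im z)) = - (2 * 'Im z) by ring: (sqrCi C).
rewrite mulmxDr mulmxDl mulmx1 mulmxZr mulmxZl mxaddE mxscaleE mulNr gerDl oppr_le0.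
apply: mulr_ge0; first by rewrite mulr_ge0.
have := psd_diag (y *m Y) i (pd_psd (pd_inv dS)).
by rewrite adjM !mulmxA.
Qed.

Lemma transfer_unit n m (a S : 'M[C]_n) (L : 'M_(n, m)) z :
  node a S L -> S \in unitmx -> a + z%:M \in unitmx -> a + (z^*)%:M \in unitmx ->
  transfer a S L z \in unitmx.
Proof.
move=> hN uS uz uz'; have := transfer_gram hN uS uz uz'.
by rewrite conjCK subrr mulr0 scale0r addr0 => /mulmx1_unit[].
Qed.

(** On vectors supported in the first block only [L1] is seen. The two Gram forms then differ just
    in [S^-1 <= B^-1], and the smaller inverse loses less norm. *)
Lemma transfer_lower n m1 m2 p (a S B : 'M[C]_n) (L1 : 'M_(n, m1)) (L2 : 'M_(n, m2))
    z (e : 'M_(m1, p)) i :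
  node a S (row_mx L1 L2) -> node a B L1 -> pd S -> pd B -> psd (S - B) ->
  a + z%:M \in unitmx -> 0 <= 'Im z ->
  ((transfer a B L1 z *m e)^t* *m (transfer a B L1 z *m e)) i i <=
  ((transfer a S (row_mx L1 L2) z *m col_mx e 0)^t* *m
   (transfer a S (row_mx L1 L2) z *m col_mx e 0)) i i.
Proof.
move=> hS hB dS dB hSB uz z0.
rewrite !adjM !mulmxA -!(mulmxA _ (_^t*) (transfer _ _ _ _)).
rewrite (transfer_gram hS (pd_unit dS) uz uz) (transfer_gram hB (pd_unit dB) uz uz).
rewrite im_eigen; have -> : 'i * ('i * (2 * 'Im z)) = - (2 * 'Im z) by ring: (sqrCi C).
rewrite mul_mx_row; set y := invmx _ *m L1; set y2 := invmx _ *m L2.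
rewrite !(mulmxDr, mulmxDl) !mulmx1 adj_col adj0 mul_row_col mul0mx addr0.
rewrite !mulmxZr !mulmxZl !mxaddE !mxscaleE lerD2l !mulNr lerN2.
apply: ler_wpM2l; first by rewrite mulr_ge0.
rewrite -subr_ge0 -mxoppE -mxaddE.
have := psd_diag (y *m e) i (psd_inv_anti dS dB hSB); congr (_ <= _ i i).
have -> : row_mx (e^t*) 0 *m ((row_mx y y2)^t* *m invmx S *m row_mx y y2) *m col_mx e 0 =
    (y *m e)^t* *m invmx S *m (y *m e).
  have <- : row_mx y y2 *m col_mx e 0 = y *m e by rewrite mul_row_col mulmx0 addr0.
  by rewrite [in RHS]adjM adj_col adj0 !mulmxA.
by rewrite mulmxBr mulmxBl adjM !mulmxA.
Qed.

(** The operator is injective on the finite-dimensional space of matrices, hence onto. *)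
Lemma lyapunov_solve n (a Q : 'M[C]_n) :
  (forall x, eigenvalue a x -> eigenvalue (a^t*) x -> False) ->
  exists X, a *m X - X *m a^t* = Q.
Proof.
move=> ha; pose f := mulmx a \- mulmxr (a^t*) : 'M[C]_n -> 'M[C]_n.
have uf : lin_mx f \in unitmx.
  rewrite -row_free_unit; apply/inj_row_free => v.
  rewrite -[v]vec_mxK mul_vec_lin /f /= => /(congr1 vec_mx).
  rewrite mxvecK linear0 => /eqP; rewrite subr_eq0 => /eqP.
  by move/(sylvester_eq0 ha) ->; rewrite linear0.
exists (vec_mx (mxvec Q *m invmx (lin_mx f))).
have := mul_vec_lin f (vec_mx (mxvec Q *m invmx (lin_mx f))).
by rewrite vec_mxK mulmxKV // => /(can_inj mxvecK) /esym.
Qed.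

End PsdOrder.

(** * Nodes and potential generated by a quadruple *)

Section Quadruple.
Context (C : numClosedFieldType) (n m1 m2 : nat).
Context (a S0 : 'M[C]_n) (t1 : 'M[C]_(n, m1)) (t2 : 'M[C]_(n, m2)).
Context (dS0 : pd S0) (r1 : reachable a t1).
Context (e0 : a *m S0 - S0 *m a^t* = 'i *: (t1 *m t1^t* + t2 *m t2^t*)).

Local Notation j := (block_mx 1%:M 0 0 (- 1%:M) : 'M[C]_(m1 + m2)).

Fixpoint node_seq k : 'M[C]_(n, m1 + m2) * 'M[C]_n :=
  if k is k'.+1 then
    let p := node_seq k' in (next_L a p.1 j, next_S a p.2 p.1 j)
  else (row_mx t1 t2, S0).
Local Notation Lk k := (node_seq k).1.
Local Notation Sk k := (node_seq k).2.

Lemma node_seqS k :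
  node_seq k.+1 = (next_L a (Lk k) j, next_S a (Sk k) (Lk k) j).
Proof. by []. Qed.

Lemma sig_adj : j^t* = j.
Proof. by rewrite adj_block !adj0 adjN !adj1. Qed.

Lemma sig_sq : j *m j = 1%:M.
Proof.
rewrite mulmx_block scalar_mx_block.
by congr block_mx; mxring.
Qed.

(** At an eigenvector [y] the identity reads [2 Im x |y|^2 = |y t1|^2 + |y t2|^2], with the norm of
    [S0] on the left; [Im x = 0] would give [y t1 = 0], against the Hautus test. *)
Lemma eigen_upper x : eigenvalue a x -> 0 < 'Im x.
Proof.
move=> /eigenvalueP[y ya y0]; have hy := dS0.2 y y0.
have := form_eigen S0 ya; rewrite e0 formZ -mulrA => /(mulfI (neq0Ci C)).
rewrite mulmxDr mulmxDl mxaddE => e.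
have p1 := (psd_gram t1).2 y; have p2 := (psd_gram t2).2 y.
have I0 : 0 <= 'Im x.
  by rewrite -(pmulr_lge0 _ hy) -(pmulr_rge0 _ (ltr0Sn C 1)) mulrA -e addr_ge0.
rewrite lt_neqAle I0 andbT eq_sym; apply: contra y0 => /eqP Ix.
move: e; rewrite Ix mulr0 mul0r => /eqP; rewrite paddr_eq0 // => /andP[/eqP yt _].
by apply/eqP/(reachable_eigen r1 ya)/gram_eq0.
Qed.

Lemma shift_unit z : 0 <= 'Im z -> a + z%:M \in unitmx.
Proof.
move=> hz; apply/negPn; rewrite -[z]opprK raddfN -eigenvalue_unitmx; apply/negP.
by move/eigen_upper; rewrite raddfN oppr_gt0 => /lt_geF; rewrite hz.
Qed.

Lemma a_unit : a \in unitmx.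
Proof. by rewrite -[a]addr0 -(raddf0 scalar_mx) shift_unit // raddf0. Qed.

(** Each step multiplies the first block of [Lambda_k] by this matrix, which commutes with [a]. *)
Local Notation E := (1%:M + 'i *: invmx a).

Lemma E_unit : E \in unitmx.
Proof.
have -> : E = invmx a *m (a + 'i%:M).
  by rewrite mulmxDr mulVmx ?a_unit // mul_mx_scalar.
by rewrite unitmx_mul unitmx_inv a_unit shift_unit // Im_i ler01.
Qed.

Lemma Lk_split k : exists G, Lk k = row_mx (E ^+ k *m t1) G.
Proof.
elim: k => [|k [G hG]]; first by exists t2; rewrite expr0 mul1mx.
rewrite node_seqS /= /next_L hG; exists (G - 'i *: (invmx a *m G)).
rewrite mul_mx_row mul_row_block scale_row_mx add_row_mx exprS -mulmxE.
by congr row_mx; mxring.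
Qed.

Lemma node_seqP k : node a (Sk k) (Lk k).
Proof.
elim: k => [|k IH]; last first.
  by rewrite node_seqS; apply: next_node; rewrite ?a_unit ?sig_adj ?sig_sq.
by split; [exact: dS0.1|rewrite /= adj_row mul_row_col].
Qed.

(* [E^k B E^k^t*] bounds [S_k] from below, with the same transfer function for all
   [k]; this keeps the growing solutions of the system from being summable. *)
Lemma base_node : exists2 B, pd B & node a B t1.
Proof.
have [B hB] : exists X, a *m X - X *m a^t* = 'i *: (t1 *m t1^t*).
  apply: lyapunov_solve => x /eigen_upper h1; rewrite eigenvalue_adj => /eigen_upper.
  by rewrite Im_conj oppr_gt0 => /(lt_trans h1); rewrite ltxx.
have dJ : B^t* = B.
  apply/eqP; rewrite -subr_eq0; apply/eqP; apply: (@sylvester_eq0 _ _ _ a (a^t*)).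
    move=> x /eigen_upper h1; rewrite eigenvalue_adj => /eigen_upper.
    by rewrite Im_conj oppr_gt0 => /(lt_trans h1); rewrite ltxx.
  have hB' : a *m B^t* - B^t* *m a^t* = 'i *: (t1 *m t1^t*).
    have := congr1 (fun M => - M^t*) hB; rewrite adjD adjN !adjM trmxCK.
    rewrite adjZ adjM trmxCK conj_i opprB => ->.
    by rewrite scaleNr opprK.
  apply/eqP; rewrite -subr_eq0; apply/eqP.
  have -> : a *m (B^t* - B) - (B^t* - B) *m a^t* =
      (a *m B^t* - B^t* *m a^t*) - (a *m B - B *m a^t*) by mxring.
  by rewrite hB' hB subrr.
exists B; last by [].
apply: (lyapunov_pd (P := t1 *m t1^t*) eigen_upper dJ (psd_gram _) _ hB).
by move=> x y ya /gram_eq0 /(reachable_eigen r1 ya).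
Qed.

Lemma comm_shift k z : E ^+ k *m (a + z%:M) = (a + z%:M) *m E ^+ k.
Proof.
elim: k => [|k IH]; first by rewrite expr0 mul1mx mulmx1.
rewrite exprS -mulmxE -mulmxA IH !mulmxA; congr (_ *m _).
by rewrite -[z%:M]scalemx1; mxnorm; rewrite mulmxV ?mulVmx ?a_unit //; mxent; ring.
Qed.

Section LowerBound.
Context (B : 'M[C]_n) (dB : pd B) (hB : node a B t1).

Let Bk k := E ^+ k *m B *m (E ^+ k)^t*.

Lemma E_exp_unit k : E ^+ k \in unitmx.
Proof.
elim: k => [|k IH]; first by rewrite expr0 unitmx1.
by rewrite exprS -mulmxE unitmx_mul E_unit.
Qed.

Lemma Bk_pd k : pd (Bk k).
Proof. by apply: pd_cong; rewrite ?E_exp_unit. Qed.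

Lemma Bk_node k : node a (Bk k) (E ^+ k *m t1).
Proof.
split; first exact: (Bk_pd k).1.
have := comm_shift k 0; rewrite raddf0 addr0 => Ea.
have aE : (E ^+ k)^t* *m a^t* = a^t* *m (E ^+ k)^t* by rewrite -!adjM Ea.
rewrite /Bk !mulmxA -Ea -!(mulmxA _ ((E ^+ k)^t*)) aE.
have -> : E ^+ k *m a *m B *m (E ^+ k)^t* - E ^+ k *m B *m (a^t* *m (E ^+ k)^t*)
   = E ^+ k *m (a *m B - B *m a^t*) *m (E ^+ k)^t* by mxring.
by rewrite hB.2 adjM; mxring.
Qed.

(** The difference satisfies a Lyapunov equation with right side ['i G G^t*], where [G] is the
    second block of [Lambda_k]. *)
Lemma Sk_ge k : psd (Sk k - Bk k).
Proof.
have [G hG] := Lk_split k.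
apply: (lyapunov_psd (P := G *m G^t*) eigen_upper _ (psd_gram _)).
  by rewrite adjD adjN (node_seqP k).1 (Bk_pd k).1.
have -> : a *m (Sk k - Bk k) - (Sk k - Bk k) *m a^t* =
    (a *m Sk k - Sk k *m a^t*) - (a *m Bk k - Bk k *m a^t*).
  by rewrite mulmxBr mulmxBl; mxent; ring.
rewrite (node_seqP k).2 (Bk_node k).2 hG adj_row mul_row_col.
by mxent; ring.
Qed.

Lemma Sk_pd k : pd (Sk k).
Proof.
have [hS pS] := Sk_ge k; split; first exact: (node_seqP k).1.
move=> x x0; rewrite -[Sk k](subrK (Bk k)) mulmxDr mulmxDl mxaddE.
by rewrite ltr_wpDl //; apply: (Bk_pd k).2.
Qed.

(** [E] commutes with [a], so passing from [B] to [Bk k] is a similarity of nodes and preserves the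
    transfer function. *)
Lemma transfer_base k z : a + z%:M \in unitmx ->
  transfer a (Bk k) (E ^+ k *m t1) z = transfer a B t1 z.
Proof.
move=> uz; rewrite /transfer /Bk; have uE := E_exp_unit k.
have -> : invmx (a + z%:M) *m (E ^+ k *m t1) = E ^+ k *m (invmx (a + z%:M) *m t1).
  apply: (can_inj (mulKmx uz)); rewrite mulKVmx // (mulmxA _ (E ^+ k)) -comm_shift.
  by rewrite -mulmxA mulKVmx.
have uE' : (E ^+ k)^t* \in unitmx by rewrite adj_unit.
have uB := pd_unit dB; clear -uE uE' uB; move: (E ^+ k) uE uE' => F uE uE'.
rewrite invmx_mul ?unitmx_mul ?uE // invmx_mul // adjM !mulmxA.
by rewrite mulmxKV // mulmxK.
Qed.

Lemma transfer_seq_lower p k z (e : 'M_(m1, p)) i : 0 <= 'Im z ->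
  ((transfer a B t1 z *m e)^t* *m (transfer a B t1 z *m e)) i i <=
  ((transfer a (Sk k) (Lk k) z *m col_mx e 0)^t* *m
   (transfer a (Sk k) (Lk k) z *m col_mx e 0)) i i.
Proof.
move=> z0; have uz := shift_unit z0.
rewrite -(transfer_base k uz); have [G hG] := Lk_split k.
have := node_seqP k; rewrite hG => hN.
by apply: transfer_lower (Bk_node k) (Sk_pd k) (Bk_pd k) (Sk_ge k) _ _.
Qed.

End LowerBound.

Lemma node_seq_pd k : pd (Sk k).
Proof. by have [B dB hB] := base_node; apply: Sk_pd dB hB k. Qed.

Definition pot_seq k : 'M[C]_(m1 + m2) :=
  j + (Lk k)^t* *m invmx (Sk k) *m Lk k
    - (Lk k.+1)^t* *m invmx (Sk k.+1) *m Lk k.+1.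

Lemma pot_seqE k : pot_seq k = step_pot a (Sk k) (Lk k) j.
Proof. by rewrite /pot_seq node_seqS. Qed.

Lemma next_S_unit k : next_S a (Sk k) (Lk k) j \in unitmx.
Proof. by have := pd_unit (node_seq_pd k.+1); rewrite node_seqS. Qed.

Lemma pot_seq_unitary k :
  exists2 U : 'M_(m1 + m2), U \is unitarymx & pot_seq k = U^t* *m j *m U.
Proof.
apply: signature_unitary.
- by rewrite pot_seqE step_pot_herm ?a_unit ?sig_adj ?sig_sq //; apply: node_seqP.
- rewrite pot_seqE step_pot_sq ?a_unit ?sig_adj ?sig_sq ?next_S_unit //.
  + by apply: shift_unit; rewrite (_ : 'Im 1 = 0) //; apply/Creal_ImP/real1.
  + exact: node_seqP.
  + exact/pd_unit/node_seq_pd.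
- have tr i := node_trace (node_seqP i) (pd_unit (node_seq_pd i)).
  move: (tr k) (tr k.+1); rewrite /pot_seq.
  move: (_ *m Lk k) (_ *m Lk k.+1) => X Y hX hY.
  by rewrite linearB linearD /= hX hY addrK.
Qed.

Lemma transfer_seq_step z k : z != 0 -> 0 <= 'Im z ->
  transfer a (Sk k.+1) (Lk k.+1) z *m (1%:M + ('i / z) *: j) =
  (1%:M + ('i / z) *: pot_seq k) *m transfer a (Sk k) (Lk k) z.
Proof.
move=> z0 Iz; rewrite pot_seqE node_seqS; apply: transfer_step => //.
- exact: a_unit.
- exact: node_seqP.
- exact/pd_unit/node_seq_pd.
- exact: sig_adj.
- exact: sig_sq.
- exact: next_S_unit.
- exact: shift_unit.
Qed.

End Quadruple.

Section Realizations.
Context (C : numClosedFieldType).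

Lemma reachableZ n p (A : 'M[C]_n) (B : 'M_(n, p)) s t : s != 0 -> t != 0 ->
  reachable A B -> reachable (s *: A) (t *: B).
Proof.
move=> s0 t0 h x hx; apply: h => k; have := hx k.
have -> : (s *: A) ^+ k = s ^+ k *: A ^+ k.
  elim: k {hx} => [|k IH]; first by rewrite !expr0 scale1r.
  by rewrite !exprS IH -!mulmxE mulmxZl mulmxZr scalerA.
rewrite mulmxZl !mulmxZr scalerA => /eqP.
by rewrite scaler_eq0 mulf_eq0 expf_eq0 (negPf s0) (negPf t0) andbF => /eqP.
Qed.

Lemma reachable_conjC n p (A : 'M[C]_n) (B : 'M_(n, p)) :
  reachable A B -> reachable (map_mx Num.conj A) (map_mx Num.conj B).
Proof.
move=> h x hx; have conjK m q (M : 'M[C]_(m, q)) : map_mx Num.conj (map_mx Num.conj M) = M.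
  by apply/matrixP=> i j; rewrite !mxE conjCK.
rewrite -[x]conjK (h (map_mx Num.conj x)) ?map_mx0 // => k.
rewrite -[RHS](map_mx0 (@Num.conj C)) -(hx k) !map_mxM conjK; congr (_ *m (_ *m _)).
elim: k {hx} => [|k IH]; first by rewrite !expr0 map_mx1.
by rewrite !exprS -!mulmxE map_mxM conjK IH.
Qed.

End Realizations.

(** * Correspondence between quadruples and minimal realizations *)

Section QuadrupleRealization.
Context (C : numClosedFieldType).

(* The Weyl function of the system generated by the quadruple, as the transfer
   function of the realization [(- quad_gamma, t2, - i t1^t* S0^-1)]. *)
Definition quad_gamma n m2 (a S0 : 'M[C]_n) (t2 : 'M_(n, m2)) : 'M_n :=
  a - 'i *: (t2 *m t2^t* *m invmx S0).

Definition quad_weyl n m1 m2 (a S0 : 'M[C]_n) (t1 : 'M_(n, m1)) (t2 : 'M_(n, m2)) z :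
    'M_(m1, m2) :=
  - 'i *: (t1^t* *m invmx S0 *m invmx (z%:M + quad_gamma a S0 t2) *m t2).

(** In the blocks of [w(0, z)], [D] is the inverse of [w22] and the Weyl function is [w12 w22^-1].
    The choice of [gamma] makes [(a + z)^-1 t2 D = (z + gamma)^-1 t2]. *)
Lemma weyl_vector n m1 m2 (a S0 : 'M[C]_n) (t1 : 'M_(n, m1)) (t2 : 'M_(n, m2)) z :
  a + z%:M \in unitmx -> z%:M + quad_gamma a S0 t2 \in unitmx ->
  exists D, col_mx (quad_weyl a S0 t1 t2 z) 1%:M =
    transfer a S0 (row_mx t1 t2) z *m col_mx 0 D.
Proof.
move=> uz ug; set y := invmx (z%:M + quad_gamma a S0 t2) *m t2.
exists (1%:M + 'i *: (t2^t* *m invmx S0 *m y)).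
rewrite /transfer mulmxBl mul1mx mulmxZl -!mulmxA mul_row_col mulmx0 add0r.
set D := 1%:M + _.
have -> : invmx (a + z%:M) *m (t2 *m D) = y.
  apply: (can_inj (mulKmx uz)); rewrite mulKVmx //.
  have -> : a + z%:M = z%:M + quad_gamma a S0 t2 + 'i *: (t2 *m t2^t* *m invmx S0).
    by rewrite /quad_gamma -addrA subrK addrC.
  rewrite mulmxDl {2}/y mulKVmx // /D; mxring.
rewrite adj_row mul_col_mx scale_col_mx opp_col_mx add_col_mx add0r.
congr col_mx; first by rewrite /quad_weyl -!mulmxA scaleNr.
by rewrite /D addrK.
Qed.

Lemma quad_riccati n m1 m2 (a S0 : 'M[C]_n) (t1 : 'M_(n, m1)) (t2 : 'M_(n, m2)) :
  pd S0 -> a *m S0 - S0 *m a^t* = 'i *: (t1 *m t1^t* + t2 *m t2^t*) ->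
  riccati (quad_gamma a S0 t2) t2 (t1^t* *m invmx S0) S0.
Proof.
move=> dS e; have uS := pd_unit dS; have hS := dS.1.
rewrite /riccati /quad_gamma adjM trmxCK adjV hS.
have -> : S0 *m (invmx S0 *m t1) *m (t1^t* *m invmx S0) *m S0 = t1 *m t1^t*.
  by rewrite !mulmxA mulmxKV // mulmxV // mul1mx.
have -> : (a - 'i *: (t2 *m t2^t* *m invmx S0)) *m S0 = a *m S0 - 'i *: (t2 *m t2^t*).
  by rewrite mulmxBl mulmxZl mulmxKV.
have -> : S0 *m (a - 'i *: (t2 *m t2^t* *m invmx S0))^t* = S0 *m a^t* + 'i *: (t2 *m t2^t*).
  adjn; rewrite hS mulmxBr; congr (_ + _).
  by rewrite mulmxZr mulKVmx // scaleNr opprK.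
have -> : a *m S0 = S0 *m a^t* + 'i *: (t1 *m t1^t* + t2 *m t2^t*).
  by rewrite -e addrC subrK.
by mxring.
Qed.

(** [gamma] is [a] with feedback through [t2]. By the node identity its adjoint is similar, via
    [S0], to [a] with feedback through [t1]. *)
Lemma quad_reachable n m1 m2 (a S0 : 'M[C]_n) (t1 : 'M_(n, m1)) (t2 : 'M_(n, m2)) :
  pd S0 -> a *m S0 - S0 *m a^t* = 'i *: (t1 *m t1^t* + t2 *m t2^t*) ->
  reachable a t1 -> reachable a t2 ->
  reachable (quad_gamma a S0 t2) t2 /\
  reachable ((quad_gamma a S0 t2)^t*) ((t1^t* *m invmx S0)^t*).
Proof.
move=> dS e r1 r2; have uS := pd_unit dS; have hS := dS.1; split.
  have := reachable_feedback (F := - 'i *: (t2^t* *m invmx S0)) r2.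
  by rewrite /quad_gamma mulmxZr scaleNr mulmxA.
have := reachable_conj _ (reachable_feedback (F := - 'i *: (t1^t* *m invmx S0)) r1).
move/(_ (invmx S0)); rewrite unitmx_inv => /(_ uS); rewrite invmxK.
rewrite adjM adjV hS trmxCK; congr (reachable _ _).
apply: (can_inj (mulKmx uS)); rewrite -!mulmxA mulKVmx //.
rewrite /quad_gamma; adjn; rewrite hS mulmxBr mulmxDl.
have -> : a *m S0 = S0 *m a^t* + 'i *: (t1 *m t1^t* + t2 *m t2^t*).
  by rewrite -e addrC subrK.
mxnorm; rewrite mulmxV // mulmxKV // mul1mx; by mxent; ring.
Qed.

Lemma quad_similar n m1 m2 (a S0 : 'M[C]_n) (t1 : 'M_(n, m1)) (t2 : 'M_(n, m2)) T k :
  a \in unitmx -> T \in unitmx ->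
  node_seq (T *m a *m invmx T) (T *m S0 *m T^t*) (T *m t1) (T *m t2) k =
  (T *m (node_seq a S0 t1 t2 k).1, T *m (node_seq a S0 t1 t2 k).2 *m T^t*).
Proof.
move=> ua uT; elim: k => [|k IH]; first by rewrite /= mul_mx_row.
rewrite !node_seqS IH /=; move: (node_seq a S0 t1 t2 k) => [L S] /=.
have uTa : T *m a \in unitmx by rewrite unitmx_mul uT.
have uT' : T^t* \in unitmx by rewrite adj_unit.
have iA : invmx (T *m a *m invmx T) = T *m invmx a *m invmx T.
  by rewrite !invmx_mul ?unitmx_inv ?unitmx_mul ?uT // invmxK mulmxA.
have iA' : invmx ((T *m a *m invmx T)^t*) = invmx (T^t*) *m invmx (a^t*) *m T^t*.
  by rewrite -[LHS]adjV iA !adjM !adjV mulmxA.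
congr (_, _); rewrite /next_L /next_S iA ?iA' ?adjM; mxnorm.
  by rewrite mulmxKV //.
by rewrite !(mulmxKV uT) !(mulmxK uT').
Qed.

Lemma pot_seq_similar n m1 m2 (a S0 : 'M[C]_n) (t1 : 'M_(n, m1)) (t2 : 'M_(n, m2)) T k :
  pd S0 -> reachable a t1 ->
  a *m S0 - S0 *m a^t* = 'i *: (t1 *m t1^t* + t2 *m t2^t*) -> T \in unitmx ->
  pot_seq (T *m a *m invmx T) (T *m S0 *m T^t*) (T *m t1) (T *m t2) k =
  pot_seq a S0 t1 t2 k.
Proof.
move=> dS r1 e uT; have ua := a_unit dS r1 e.
have uT' : T^t* \in unitmx by rewrite adj_unit.
rewrite /pot_seq !quad_similar //.
have inv i (L := (node_seq a S0 t1 t2 i).1) (S := (node_seq a S0 t1 t2 i).2) :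
    (T *m L)^t* *m invmx (T *m S *m T^t*) *m (T *m L) = L^t* *m invmx S *m L.
  have uS : S \in unitmx by apply/pd_unit/node_seq_pd.
  rewrite !invmx_mul ?unitmx_mul ?uT // adjM !mulmxA.
  by rewrite mulmxK // mulmxKV.
by have := inv k.+1; have := inv k; move=> /= -> ->.
Qed.

Lemma pot_seq_unique n n' m1 m2 (a S0 : 'M[C]_n) (t1 : 'M_(n, m1)) (t2 : 'M_(n, m2))
    (a' S0' : 'M[C]_n') (t1' : 'M_(n', m1)) (t2' : 'M_(n', m2)) (Z : C -> Prop) k :
  pd S0 -> a *m S0 - S0 *m a^t* = 'i *: (t1 *m t1^t* + t2 *m t2^t*) ->
  reachable a t1 -> reachable a t2 ->
  pd S0' -> a' *m S0' - S0' *m a'^t* = 'i *: (t1' *m t1'^t* + t2' *m t2'^t*) ->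
  reachable a' t1' -> reachable a' t2' ->
  (forall P, large P -> exists2 z, Z z & P z) ->
  (forall z, Z z -> quad_weyl a S0 t1 t2 z = quad_weyl a' S0' t1' t2' z) ->
  pot_seq a S0 t1 t2 k = pot_seq a' S0' t1' t2' k.
Proof.
move=> dS e r1 r2 dS' e' r1' r2' hZ hw.
have [rg rgc] := quad_reachable dS e r1 r2.
have [rg' rgc'] := quad_reachable dS' e' r1' r2'.
have ric := quad_riccati dS e; have ric' := quad_riccati dS' e'.
set g := quad_gamma a S0 t2 in rg rgc ric *.
set g' := quad_gamma a' S0' t2' in rg' rgc' ric' *.
pose c := t1^t* *m invmx S0; pose c' := t1'^t* *m invmx S0'.
(* [state_space_iso] speaks of transposes, [quad_reachable] of adjoints; entrywise conjugation
   connects them. *)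
have trA p q (M : 'M[C]_(p, q)) : M^T = map_mx Num.conj (M^t*).
  by apply/matrixP=> i l; rewrite !mxE conjCK.
have trN p (M : 'M[C]_p) : (- M)^T = - M^T by apply: linearN.
have rN (p q : nat) (M : 'M[C]_p) (N : 'M_(p, q)) : reachable M N -> reachable (- M) N.
  by move=> h; rewrite -scaleN1r -[N]scale1r; apply: reachableZ; rewrite ?oner_eq0 // oppr_eq0 oner_eq0.
have o : reachable (- g)^T c^T.
  by rewrite trN; apply: rN; rewrite (trA _ _ g) (trA _ _ c); apply: reachable_conjC.
have o' : reachable (- g')^T c'^T.
  by rewrite trN; apply: rN; rewrite (trA _ _ g') (trA _ _ c'); apply: reachable_conjC.
have [|T [T' [TT' T'T TA TB cT]]] := state_space_iso (rN _ _ _ _ rg) o (rN _ _ _ _ rg') o'.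
  move=> l; apply/eqP; rewrite -subr_eq0; apply/eqP.
  (* The difference of the two Weyl functions is realized by a block diagonal system; its vanishing
     on [Z] makes the coefficients agree. *)
  have := @markov_eq0 _ _ _ _ (block_mx (- g) 0 0 (- g')) (col_mx t2 t2') (row_mx c (- c')) Z hZ.
  have pw : (block_mx (- g) 0 0 (- g')) ^+ l = block_mx ((- g) ^+ l) 0 0 ((- g') ^+ l).
    elim: l => [|l IH]; first by rewrite !expr0 -scalar_mx_block.
    by rewrite !exprS -!mulmxE IH mulmx_block !(mul0mx, mulmx0, addr0, add0r).
  move=> mk; have := mk _ l; rewrite pw mul_row_block mul_row_col.
  rewrite !(mulmx0, addr0, add0r, mulNmx) => -> //.
  move=> z zZ; rewrite scalar_block !oppr0 !opprK.
  rewrite block_diag_mx_unit => /andP[u u'].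
  rewrite invmx_block_diag ?block_diag_mx_unit ?u //.
  rewrite mul_row_block mul_row_col !(mulmx0, addr0, add0r, mulNmx).
  have := hw z zZ; rewrite /quad_weyl -/g -/g' -/c -/c'.
  move/(scalerI _) => -> //; last by rewrite oppr_eq0 neq0Ci.
  by rewrite subrr.
have nn : n' = n.
  apply/eqP; rewrite eqn_leq; apply/andP; split.
    by rewrite -(mxrank1 C n') -TT' mulmx_max_rank.
  by rewrite -(mxrank1 C n) -T'T mulmx_max_rank.
subst n'; have [uT _] := mulmx1_unit TT'.
have gT : g' = T *m g *m invmx T.
  apply: oppr_inj; rewrite -mulNmx -mulmxN TA mulmxK //.
have cE : c' = c *m invmx T by rewrite -cT mulmxK.
have uT' : T^t* \in unitmx by rewrite adj_unit.
(* [S0] transported along [T] solves the Riccati equation of the second realization, whose positive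
   definite solution is unique. *)
have S'E : S0' = T *m S0 *m T^t*.
  apply: (riccati_unique rg' dS' _ ric'); first exact: pd_cong.
  move: ric; rewrite -/c -/c' /riccati gT -TB cE; clear -uT uT'; clearbody c g => ric.
  have -> : T *m S0 *m T^t* *m (c *m invmx T)^t* *m (c *m invmx T) *m (T *m S0 *m T^t*)
     - T *m t2 *m (T *m t2)^t* = T *m (S0 *m c^t* *m c *m S0 - t2 *m t2^t*) *m T^t*.
    rewrite !adjM adjV; mxnorm; rewrite mulmxK // mulmxKV //.
  have -> : T *m g *m invmx T *m (T *m S0 *m T^t*) - T *m S0 *m T^t* *m (T *m g *m invmx T)^t*
     = T *m (g *m S0 - S0 *m g^t*) *m T^t*.
    rewrite !adjM adjV; mxnorm; rewrite mulmxK // mulmxKV //.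
  by rewrite ric mulmxZr mulmxZl.
have uS := pd_unit dS; have uS' := pd_unit dS'.
have t1E : t1' = T *m t1.
  have -> : t1' = S0' *m c'^t* by rewrite /c' adjM trmxCK adjV dS'.1 mulKVmx.
  rewrite S'E cE adjM adjV mulmxA mulmxK // -mulmxA; congr (_ *m _).
  by rewrite /c adjM trmxCK adjV dS.1 mulKVmx.
have aE : a' = T *m a *m invmx T.
  have -> : a' = g' + 'i *: (t2' *m t2'^t* *m invmx S0') by rewrite /g' /quad_gamma subrK.
  have -> : a = g + 'i *: (t2 *m t2^t* *m invmx S0) by rewrite /g /quad_gamma subrK.
  rewrite gT S'E -TB !invmx_mul ?unitmx_mul ?uT // adjM; mxnorm.
  by rewrite mulmxK.
by rewrite aE S'E t1E -TB pot_seq_similar.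
Qed.

(* [X] solves the Riccati equation of the realization [(- A, B, 'i c)]. *)
Lemma quad_exists n m1 m2 (A : 'M[C]_n) (B : 'M_(n, m2)) (c : 'M_(m1, n)) :
  reachable A B -> reachable A^T c^T ->
  exists (a S0 : 'M[C]_n) (t1 : 'M_(n, m1)) (t2 : 'M_(n, m2)),
    [/\ pd S0, a *m S0 - S0 *m a^t* = 'i *: (t1 *m t1^t* + t2 *m t2^t*),
     reachable a t1, reachable a t2 &
     forall z, quad_weyl a S0 t1 t2 z = c *m invmx (z%:M - A) *m B].
Proof.
move=> rB rc; pose g := - A; pose h := 'i *: c.
have rg : reachable g B.
  by rewrite /g -scaleN1r -[B]scale1r; apply: reachableZ; rewrite ?oner_eq0 // oppr_eq0 oner_eq0.
have rh : reachable (g^t*) (h^t*).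
  rewrite /g /h adjN adjZ -scaleN1r; apply: reachableZ.
  - by rewrite oppr_eq0 oner_eq0.
  - by rewrite conj_i oppr_eq0 neq0Ci.
  - exact: reachable_conjC rc.
have [X dX ric] := riccati_exists rg rh.
have uX := pd_unit dX; have hX := dX.1.
pose a := g + 'i *: (B *m B^t* *m invmx X); pose t1 := X *m h^t*.
have gE : quad_gamma a X B = g by rewrite /quad_gamma /a addrK.
(* In this form [a] is similar, via [X], to [g^t*] with feedback through [h^t*], which gives
   controllability with [t1]. *)
have aX : a *m X = X *m (g^t* + 'i *: (h^t* *m h *m X)).
  have -> : a *m X = g *m X + 'i *: (B *m B^t*) by rewrite /a mulmxDl mulmxZl mulmxKV.
  have -> : g *m X = X *m g^t* + 'i *: (X *m h^t* *m h *m X - B *m B^t*).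
    by rewrite -ric addrC subrK.
  by mxring.
exists a, X, t1, B; split=> //.
- have -> : X *m a^t* = (a *m X)^t* by rewrite adjM hX.
  have {1}-> : a *m X = g *m X + 'i *: (B *m B^t*) by rewrite /a mulmxDl mulmxZl mulmxKV.
  rewrite aX /t1; adjn; rewrite hX.
  by mxring.
- have -> : a = X *m (g^t* + h^t* *m ('i *: (h *m X))) *m invmx X.
    rewrite mulmxZr mulmxA -aX mulmxK //.
  by apply: reachable_conj => //; apply: reachable_feedback.
- have -> : a = g + B *m ('i *: (B^t* *m invmx X)) by rewrite mulmxZr mulmxA.
  exact: reachable_feedback.
- move=> z; rewrite /quad_weyl gE /t1 adjM trmxCK hX mulmxK // /h.
  by rewrite !mulmxZl scalerA mulNr -expr2 sqrCi opprK scale1r.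
Qed.

End QuadrupleRealization.

Require Import Defs.
From mathcomp Require Import complex.
From mathcomp Require Import all_classical all_reals all_analysis.
Import Order.TTheory GRing.Theory Num.Theory numFieldNormedType.Exports.
Local Open Scope ring_scope.
Local Open Scope complex_scope.
Local Open Scope sesquilinear_scope.

(** * Weyl functions *)

Section ComplexSeries.
Context (R : realType).

Lemma normc_le_ReIm (x : R[i]) : `|x| <= (`|complex.Re x| + `|complex.Im x|)%:C.
Proof.
rewrite {1}[x]complexE (le_trans (ler_normD _ _)) // normrM.
have normR (r : R) : `|r%:C| = `|r|%:C :> R[i].
  by rewrite normc_def /= expr0n addr0 sqrtr_sqr.
rewrite complexiE normCi mul1r !normR.
by rewrite (rmorphD (real_complex R)).
Qed.

Lemma normc_ge_Im (x : R[i]) : `|complex.Im x|%:C <= `|x|.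
Proof.
have := normc_ge_Re (x * 'i%C).
by rewrite ReiNIm normrN normrM complexiE normCi mulr1.
Qed.

(** The geometric majorant applies to the real and imaginary parts, so completeness of [R]
    suffices. *)
Lemma complex_series_cvg (u : nat -> R[i]) (K q : R) :
  0 <= q < 1 -> (forall k, `|u k| <= (K * q ^+ k)%:C) ->
  exists l, forall eps : R[i], 0 < eps -> exists N : nat, forall n, (N <= n)%N ->
    `|l - \sum_(0 <= k < n) u k| < eps.
Proof.
move=> /andP[q0 q1] hu.
have geo : cvgn (series (geometric K q : R^o ^nat)).
  by apply: is_cvg_geometric_series; rewrite ger0_norm.
have dominated (x : nat -> R) : (forall k, `|x k| <= K * q ^+ k) ->
    exists l, forall e : R, 0 < e -> exists N : nat, forall n, (N <= n)%N ->
      `|l - \sum_(0 <= k < n) x k| < e.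
  move=> hx; have cx : cvgn (series (x : R^o ^nat)).
    apply: normed_cvg; apply: series_le_cvg geo => k //=.
    by rewrite (le_trans _ (hx k)).
  exists (limn (series (x : R^o ^nat))) => e e0.
  move/cvgrPdist_lt : cx => /(_ _ e0)[N _ hN].
  by exists N => n /hN.
have [a ha] : exists l, forall e : R, 0 < e -> exists N : nat, forall n, (N <= n)%N ->
      `|l - \sum_(0 <= k < n) complex.Re (u k)| < e.
  by apply: dominated => k; rewrite -lecR (le_trans (normc_ge_Re _)).
have [b hb] : exists l, forall e : R, 0 < e -> exists N : nat, forall n, (N <= n)%N ->
      `|l - \sum_(0 <= k < n) complex.Im (u k)| < e.
  by apply: dominated => k; rewrite -lecR (le_trans (normc_ge_Im _)).
exists (a +i* b) => -[eps im] /[dup]; rewrite {1}ltcE /= => /andP[/eqP -> e0] _.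
have e2 : 0 < eps / 2 by rewrite divr_gt0.
have [N1 h1] := ha _ e2; have [N2 h2] := hb _ e2.
exists (maxn N1 N2) => n; rewrite geq_max => /andP[/h1 {}h1 /h2 {}h2].
apply: le_lt_trans (normc_le_ReIm _) _.
have ReD : {morph (@complex.Re R) : x y / x + y >-> x + y} by case=> ? ? [].
have ImD : {morph (@complex.Im R) : x y / x + y >-> x + y} by case=> ? ? [].
have ReN (x : R[i]) : complex.Re (- x) = - complex.Re x by case: x.
have ImN (x : R[i]) : complex.Im (- x) = - complex.Im x by case: x.
have Re0 : complex.Re (0 : R[i]) = 0 by [].
have Im0 : complex.Im (0 : R[i]) = 0 by [].
rewrite ReD ImD ReN ImN (big_morph _ ReD Re0) (big_morph _ ImD Im0).
by rewrite ltcR /= [ltRHS]splitr ltrD.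
Qed.

Lemma mx_series_cvg m (u : nat -> 'M[R[i]]_m) (K q : R) :
  0 <= q < 1 -> (forall k i j, `|u k i j| <= (K * q ^+ k)%:C) ->
  cvgn (series (u : nat -> 'M[R[i] : numFieldType]_m)).
Proof.
move=> hq hu.
have /choice [f hf] (ij : 'I_m * 'I_m) := complex_series_cvg hq (fun k => hu k ij.1 ij.2).
apply/cvg_ex; exists (\matrix_(i, j) f (i, j) : 'M[R[i] : numFieldType]_m).
apply/cvg_ballP => eps e0.
have /choice [N hN] (ij : 'I_m * 'I_m) := hf ij eps e0.
exists (\max_ij N ij) => // n /= hn; split=> // i j.
have := hN (i, j) n (leq_trans (leq_bigmax (i, j)) hn).
rewrite /ball /= /ball_ mxE /series /= summxE.
done.
Qed.

Lemma mx_series_small m (u : nat -> 'M[R[i]]_m) :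
  cvgn (series (u : nat -> 'M[R[i] : numFieldType]_m)) ->
  forall i j (eps : R[i]), 0 < eps -> exists N : nat, forall n, (N <= n)%N ->
  `|u n i j| < eps.
Proof.
move=> /cvg_series_cvg_0 /cvg_ballP h i j eps /h[N _ hN].
exists N => n /hN /= [_ /(_ i j)].
by rewrite /ball /= /ball_ mxE sub0r normrN.
Qed.

End ComplexSeries.

(** * Gram matrices and the multipliers of the constant system *)

Section Gram.
Context (C : numClosedFieldType).

Lemma gram_diag m n (M : 'M[C]_(m, n)) i : (M^t* *m M) i i = \sum_k `|M k i| ^+ 2.
Proof. by rewrite mxE; apply: eq_bigr => k _; rewrite adjE mulrC -normCK. Qed.

Lemma gram_diag_ge0 m n (M : 'M[C]_(m, n)) i : 0 <= (M^t* *m M) i i.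
Proof. by rewrite gram_diag; apply: sumr_ge0 => k _; apply: exprn_ge0. Qed.

Lemma gram_diagZ m n x (M : 'M[C]_(m, n)) i :
  ((x *: M)^t* *m (x *: M)) i i = `|x| ^+ 2 * (M^t* *m M) i i.
Proof. by rewrite adjZ mulmxZl mulmxZr scalerA mxscaleE [_^* * _]mulrC -normCK. Qed.

Lemma mul_le_sum_sqr (x y : C) : 0 <= x -> 0 <= y -> x * y <= x ^+ 2 + y ^+ 2.
Proof.
move=> x0 y0.
have h : 0 <= (x - y) ^+ 2 by rewrite real_exprn_even_ge0 // rpredB // ger0_real.
have h2 : 0 <= x ^+ 2 + y ^+ 2 by rewrite addr_ge0 ?exprn_ge0.
rewrite -subr_ge0 -(pmulr_rge0 _ (ltr0Sn C 1)).
have -> : 2 * (x ^+ 2 + y ^+ 2 - x * y) = (x - y) ^+ 2 + (x ^+ 2 + y ^+ 2) by ring.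
exact: addr_ge0.
Qed.

Lemma gram_entry m n (M : 'M[C]_(m, n)) i j :
  `|(M^t* *m M) i j| <= (M^t* *m M) i i + (M^t* *m M) j j.
Proof.
rewrite !gram_diag -big_split mxE (le_trans (ler_norm_sum _ _ _)) //.
apply: ler_sum => k _; rewrite adjE normrM norm_conjC.
exact: mul_le_sum_sqr.
Qed.

(** The two sides differ by the diagonal of the Gram matrix of [A + 2 B]. If the sum [A + B] and the
    part [B] are small, so is [A]. *)
Lemma gram_diag_parallelogram m n (A B : 'M[C]_(m, n)) i :
  (A^t* *m A) i i <= 2 * ((A + B)^t* *m (A + B)) i i + 2 * (B^t* *m B) i i.
Proof.
have -> : 2 * ((A + B)^t* *m (A + B)) i i + 2 * (B^t* *m B) i i =
    (A^t* *m A) i i + ((A + (2 : C) *: B)^t* *m (A + (2 : C) *: B)) i i.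
  rewrite !adjD adjZ conjC_nat; mxnorm; rewrite !(mxaddE, mxscaleE); ring.
by rewrite lerDl gram_diag_ge0.
Qed.

Lemma gram_diag_eq0 m n (M : 'M[C]_(m, n)) :
  (forall i, (M^t* *m M) i i = 0) -> M = 0.
Proof.
move=> h; apply/matrixP=> k i; rewrite mxE; apply/eqP.
have /eqP := h i; rewrite gram_diag psumr_eq0 => [/allP/(_ k)|l _]; last exact: exprn_ge0.
by rewrite mem_index_enum /= sqrf_eq0 normr_eq0 => /(_ isT).
Qed.

Lemma normr_subi (z : C) : `|z - 'i| ^+ 2 = `|z| ^+ 2 - 2 * 'Im z + 1.
Proof.
rewrite !normCK rmorphB /= conj_i.
have -> : z * z^* - 2 * 'Im z + 1 = z * z^* + 'i * (z - z^*) + 1.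
  by rewrite im_eigen; ring: (sqrCi C).
by ring: (sqrCi C).
Qed.

(** From [|z - i|^2 = |z|^2 - 2 Im z + 1], at [z] and at [- z]. *)
Lemma multiplier_bounds (z : C) : 1 <= 'Im z ->
  [/\ z != 0, `|1 - 'i / z| < 1 & 1 <= `|1 + 'i / z|].
Proof.
move=> Iz; have Iz0 : 0 < 'Im z := lt_le_trans ltr01 Iz.
have z0 : z != 0 by apply: contraTneq Iz0 => ->; rewrite raddf0 ltxx.
have nz : 0 < `|z| by rewrite normr_gt0.
have -> : 1 - 'i / z = (z - 'i) / z by field.
have -> : 1 + 'i / z = - ((- z - 'i) / z) by field.
rewrite normrN !normf_div; split=> //.
  rewrite ltr_pdivrMr // mul1r -(@ltr_pXn2r _ 2) ?nnegrE // normr_subi.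
  by rewrite -addrA gtrDl addrC subr_lt0 (lt_le_trans _ (_ : 2 <= _)) ?ltr1n // ler_peMr.
rewrite ler_pdivlMr // mul1r -(@ler_pXn2r _ 2) ?nnegrE // normr_subi normrN.
rewrite raddfN /= mulrN opprK -addrA lerDl addr_ge0 // mulr_ge0 // ltW //.
Qed.

End Gram.

(** * The Weyl function of a generated system *)

Section Weyl.
Context (R : realType) (n m1 m2 : nat).
Context (a S0 : 'M[R[i]]_n) (t1 : 'M[R[i]]_(n, m1)) (t2 : 'M[R[i]]_(n, m2)).
Context (dS0 : pd S0) (r1 : reachable a t1).
Context (e0 : a *m S0 - S0 *m a^t* = 'i%R *: (t1 *m t1^t* + t2 *m t2^t*)).

Lemma node_seq_Lam_Smx k :
  node_seq a S0 t1 t2 k = (Lam a t1 t2 k, Smx a S0 t1 t2 k).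
Proof. by elim: k => [//|k IH]; rewrite node_seqS IH. Qed.

Lemma potentialE k : potential a S0 t1 t2 k = pot_seq a S0 t1 t2 k.
Proof. by rewrite /pot_seq !node_seq_Lam_Smx. Qed.

Local Notation w k z := (transfer a (node_seq a S0 t1 t2 k).2 (node_seq a S0 t1 t2 k).1 z).

Lemma sig_mul p c (e1 : 'M[R[i]]_(m1, p)) (e2 : 'M[R[i]]_(m2, p)) :
  (1%:M + c *: block_mx 1%:M 0 0 (- 1%:M)) *m col_mx e1 e2 =
  col_mx ((1 + c) *: e1) ((1 - c) *: e2).
Proof.
rewrite mulmxDl mul1mx mulmxZl mul_block_col !mul0mx addr0 add0r mul1mx mulNmx mul1mx.
rewrite scale_col_mx add_col_mx scalerN.
by rewrite !scalerDl scaleNr !scale1r.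
Qed.

(** Solutions of the system are the images under the Darboux matrices of the explicit solutions for
    the constant potential [j]. *)
Lemma fundamental_transfer p z k (e1 : 'M[R[i]]_(m1, p)) (e2 : 'M[R[i]]_(m2, p)) C :
  (forall i, C i = pot_seq a S0 t1 t2 i) -> z != 0 -> 0 <= 'Im z ->
  fundamental C z k *m (w 0 z *m col_mx e1 e2) =
  w k z *m col_mx ((1 + 'i / z)%R ^+ k *: e1) ((1 - 'i / z)%R ^+ k *: e2).
Proof.
move=> hC z0 Iz; elim: k => [|k IH].
  by rewrite !expr0 !scale1r mul1mx.
have st := transfer_seq_step dS0 r1 e0 k z0 Iz.
rewrite -[fundamental C z k.+1]/((1%:M + ('i / z)%R *: C k) *m fundamental C z k).
by rewrite -mulmxA IH hC mulmxA -st -mulmxA sig_mul !scalerA -!exprS.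
Qed.


Local Notation c z := (1 - 'i%R / z)%R.

Lemma weyl_termE C (phi : R[i] -> 'M[R[i]]_(m1, m2)) z k :
  weyl_term C phi z k = (fundamental C z k *m col_mx (phi z) 1%:M)^t*
    *m (fundamental C z k *m col_mx (phi z) 1%:M).
Proof. by rewrite /weyl_term adjM adj_col adj1 !mulmxA. Qed.

Lemma Im_geE (z : R[i]) (x : R) : (x < complex.Im z)%R -> x%:C <= 'Im z.
Proof. by move=> h; rewrite -complexIm lecR ltW. Qed.

Lemma norm_gtIm (z : R[i]) (x : R) : (x < complex.Im z)%R -> x%:C < `|z|.
Proof.
move=> h; apply: lt_le_trans (normc_ge_Im z).
by rewrite ltcR (lt_le_trans h) // ler_norm.
Qed.

Lemma decaying_series p z (D : 'M[R[i]]_(m2, p)) : 1 <= 'Im z ->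
  cvgn (series ((fun k => (w k z *m col_mx 0 (c z ^+ k *: D))^t* *m
     (w k z *m col_mx 0 (c z ^+ k *: D))) : nat -> 'M[R[i] : numFieldType]_p)).
Proof.
move=> Iz; have [z0 c1 _] := multiplier_bounds Iz.
have Iz0 : 0 <= 'Im z := le_trans ler01 Iz.
pose G i := (D^t* *m D) i i.
have G0 i : 0 <= G i by apply: gram_diag_ge0.
(* Doubled because [gram_entry] bounds an entry by two diagonal entries. *)
pose K := \sum_i G i + \sum_i G i.
have K0 : 0 <= K by rewrite addr_ge0 ?sumr_ge0.
have KE : (complex.Re K)%:C = K by rewrite RRe_real // ger0_real.
have qE : (complex.Re `|c z|)%:C = `|c z| by rewrite RRe_real // normr_real.
apply: (@mx_series_cvg _ _ _ (complex.Re K) (complex.Re `|c z| ^+ 2)).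
  have q0 : (0 <= complex.Re `|c z|)%R by rewrite -ler0c qE.
  have q1 : (complex.Re `|c z| < 1)%R by rewrite -ltcR qE; exact: c1.
  by rewrite exprn_ge0 //= expr_lt1.
move=> k i j; apply: le_trans (gram_entry _ _ _) _.
have bound l : ((w k z *m col_mx 0 (c z ^+ k *: D))^t* *m
     (w k z *m col_mx 0 (c z ^+ k *: D))) l l <= (\sum_i G i) * `|c z| ^+ 2 ^+ k.
  apply: le_trans (transfer_contractive _ _ (node_seqP dS0 r1 e0 k)
    (node_seq_pd dS0 r1 e0 k) (shift_unit dS0 r1 e0 Iz0) Iz0) _.
  rewrite adj_col adj0 mul_row_col mul0mx add0r gram_diagZ normrX exprAC [leRHS]mulrC ler_wpM2l ?exprn_ge0 //.
  by rewrite (bigD1 l) //= lerDl sumr_ge0.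
rewrite (rmorphM (real_complex R)) !(rmorphXn (real_complex R)) /= KE qE.
by rewrite /K mulrDl lerD.
Qed.

Lemma quad_weyl_function C (phi : R[i] -> 'M[R[i]]_(m1, m2)) :
  (forall k, C k = potential a S0 t1 t2 k) ->
  large (fun z => phi z = quad_weyl a S0 t1 t2 z) -> weyl_function C phi.
Proof.
move=> hC /large_and /(_ (large_resolvent (- quad_gamma a S0 t2))) [r r0 hr].
have rE : (complex.Re r)%:C = r by rewrite RRe_real // gtr0_real.
have r0' : (0 < complex.Re r)%R by rewrite -ltcR rE; exact: r0.
(* Above this height both [Im z >= 1] and [|z| > r] hold. *)
exists (complex.Re r + 1)%R => [|z hz]; first exact: addr_gt0.
have Iz : 1 <= 'Im z by apply: (Im_geE (x := 1)); apply: lt_trans hz; rewrite ltrDr.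
have Iz0 : 0 <= 'Im z := le_trans ler01 Iz.
have [z0 _ _] := multiplier_bounds Iz.
have [|phiE ug] := hr z.
  by rewrite -rE; apply: norm_gtIm; apply: lt_trans hz; rewrite ltrDl.
rewrite opprK in ug.
have [D hD] := weyl_vector t1 (shift_unit dS0 r1 e0 Iz0) ug.
have -> : weyl_term C phi z = fun k => (w k z *m col_mx 0 (c z ^+ k *: D))^t* *m
     (w k z *m col_mx 0 (c z ^+ k *: D)).
  apply/funext => k; rewrite weyl_termE phiE hD.
  have hC' i : C i = pot_seq a S0 t1 t2 i by rewrite hC potentialE.
  have ft := fundamental_transfer k (0 : 'M[R[i]]_(m1, m2)) D hC' z0 Iz0.
  rewrite scaler0 in ft.
  exact: (congr1 (fun M => M^t* *m M) ft).
exact: decaying_series.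
Qed.

(** Pulling [col_mx (phi z) 1%:M] back by [w(0, z)] gives blocks [E1], [E2]. Summability forces
    [E1 = 0]; the identity in the lower block then determines [E2], hence [phi z]. *)
Lemma weyl_function_unique C (phi : R[i] -> 'M[R[i]]_(m1, m2)) :
  (forall k, C k = potential a S0 t1 t2 k) -> weyl_function C phi ->
  exists M : R, forall z, (M < complex.Im z)%R -> phi z = quad_weyl a S0 t1 t2 z.
Proof.
move=> hC [M M0 hM].
have [r r0 hr] := large_and (large_resolvent (- quad_gamma a S0 t2))
   (large_resolvent (- a)).
have rE : (complex.Re r)%:C = r by rewrite RRe_real // gtr0_real.
have r0' : (0 < complex.Re r)%R by rewrite -ltcR rE; exact: r0.
exists (M + (complex.Re r + 1))%R => z hz.
have hMz : (M < complex.Im z)%R by apply: lt_trans hz; rewrite ltrDl addr_gt0.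
have Iz : 1 <= 'Im z.
  apply: (Im_geE (x := 1)); apply: lt_trans hz.
  by rewrite addrA ltrDr addr_gt0.
have hrz : r < `|z|.
  rewrite -rE; apply: norm_gtIm; apply: lt_trans hz.
  by rewrite addrCA ltrDl addr_gt0.
have Iz0 : 0 <= 'Im z := le_trans ler01 Iz.
have [z0 _ c1] := multiplier_bounds Iz.
have [ug _] := hr z hrz; rewrite opprK in ug.
(* The conjugate point has the same modulus, and [transfer_unit] asks for invertibility at both
   points. *)
have hrzJ : r < `|z^*%R| by rewrite norm_conjC.
have [_ uJ] := hr _ hrzJ; rewrite opprK addrC in uJ.
have uz := shift_unit dS0 r1 e0 Iz0.
have uw : w 0 z \in unitmx.
  by apply: transfer_unit (node_seqP dS0 r1 e0 0) _ uz uJ; apply: pd_unit.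
pose E : 'M[R[i]]_(m1 + m2, m2) := invmx (w 0 z) *m col_mx (phi z) 1%:M.
pose E1 := usubmx E; pose E2 := dsubmx E.
have wE : col_mx (phi z) 1%:M = w 0 z *m col_mx E1 E2 by rewrite vsubmxK mulKVmx.
have [B dB hB] := base_node dS0 r1 e0.
pose Bk k := w k z *m col_mx 0 (c z ^+ k *: E2).
pose Ak k := w k z *m col_mx ((1 + 'i%R / z) ^+ k *: E1) 0.
have sumE k : weyl_term C phi z k = (Ak k + Bk k)^t* *m (Ak k + Bk k).
  have hC' i : C i = pot_seq a S0 t1 t2 i by rewrite hC potentialE.
  rewrite weyl_termE wE (fundamental_transfer k E1 E2 hC' z0 Iz0).
  by rewrite /Ak /Bk -mulmxDr add_col_mx addr0 add0r.
have E10 : E1 = 0.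
  have uB : transfer a B t1 z \in unitmx.
    exact: transfer_unit hB (pd_unit dB) uz uJ.
  suff h : transfer a B t1 z *m E1 = 0 by rewrite -(mulKmx uB E1) h mulmx0.
  apply: gram_diag_eq0 => i; set t := (_ *m _) i i.
  have t0 : 0 <= t by apply: gram_diag_ge0.
  apply/eqP; rewrite eq_le t0 andbT; apply/negPn/negP => tn.
  have {tn}t0 : 0 < t.
    by rewrite lt_neqAle t0 andbT; apply: contra tn => /eqP <-.
  (* [t] bounds the growing terms from below, and the parallelogram bound has two terms with factor
     2: a quarter of [t] for each gives the contradiction. *)
  have e0' : 0 < t / 4 by rewrite divr_gt0.
  have [N1 h1] := mx_series_small (hM z hMz) i i e0'.
  have [N2 h2] := mx_series_small (decaying_series (D := E2) Iz) i i e0'.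
  pose k := maxn N1 N2.
  have := h1 k (leq_maxl _ _); have := h2 k (leq_maxr _ _); rewrite sumE -/(Bk k).
  rewrite !ger0_norm ?gram_diag_ge0 // => b1 b2.
  have le1 : t <= ((Ak k)^t* *m Ak k) i i.
    apply: le_trans (transfer_seq_lower dS0 r1 e0 dB hB k E1 i Iz0) _.
    have -> : Ak k = (1 + 'i%R / z) ^+ k *: (w k z *m col_mx E1 0).
      by rewrite /Ak -mulmxZr scale_col_mx scaler0.
    by rewrite gram_diagZ ler_peMl ?gram_diag_ge0 // normrX !exprn_ege1.
  have := le_trans le1 (gram_diag_parallelogram (Ak k) (Bk k) i).
  suff /lt_le_trans h : 2 * ((Ak k + Bk k)^t* *m (Ak k + Bk k)) i i
      + 2 * ((Bk k)^t* *m Bk k) i i < t by move/h; rewrite ltxx.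
  have -> : t = 2 * (t / 4) + 2 * (t / 4) by field.
  by rewrite ltrD // ltr_pM2l.
have [D hD] := weyl_vector t1 uz ug.
have : w 0 z *m col_mx 0 (E2 - D) = col_mx (phi z - quad_weyl a S0 t1 t2 z) 0.
  rewrite -[0 in RHS](subrr 1%:M) -add_col_mx -opp_col_mx hD wE E10 -mulmxBr.
  by rewrite opp_col_mx add_col_mx subr0.
have tE : w 0 z = block_mx (ulsubmx (w 0 z)) (ursubmx (w 0 z)) (dlsubmx (w 0 z)) (drsubmx (w 0 z)).
  by rewrite submxK.
set q := quad_weyl _ _ _ _ _ => eqD.
(* The lower block of [hD] says that the lower right block of [w(0, z)] has the right inverse [D],
   hence is invertible. *)
move: (hD); rewrite {1}tE mul_block_col !mulmx0 !add0r => /eq_col_mx[_ /esym DD].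
have [uD _] := mulmx1_unit DD.
move: eqD; rewrite {1}tE mul_block_col !mulmx0 !add0r => /eq_col_mx[h1 h2].
have ED : E2 - D = 0 by rewrite -(mulKmx uD (E2 - D)) h2 mulmx0.
by apply/eqP; rewrite -subr_eq0 -h1 ED mulmx0.
Qed.

End Weyl.

Section PositiveDefinite.
Context (C : numClosedFieldType).

Lemma pd_eigen n (X : 'M[C]_n) : pd X ->
  X \is hermsymmx /\ forall a, eigenvalue X a -> 0 < a.
Proof.
move=> [hX pX]; split; first by apply/is_hermitianmxP; rewrite expr0 scale1r hX.
move=> x /eigenvalueP[v vX v0]; have := pX v v0.
rewrite vX mulmxZl mxscaleE pmulr_lgt0 // lt_neqAle rV_norm_ge0 andbT eq_sym.
by apply: contra v0 => /eqP /rV_norm_eq0 ->.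
Qed.

(** In a unitary eigenbasis the form is the sum of [d_i |y_i|^2] with the eigenvalues [d_i]. *)
Lemma eigen_pd n (X : 'M[C]_n) : X \is hermsymmx ->
  (forall a, eigenvalue X a -> 0 < a) -> pd X.
Proof.
move=> hX ev.
have XJ : X^t* = X by have /is_hermitianmxP := hX; rewrite expr0 scale1r => {2}->.
split=> // x x0; have /orthomx_spectralP := hermitian_normalmx hX.
set P := spectralmx X; set d := spectral_diag X.
have uP : P \is unitarymx := spectral_unitarymx X.
have Pu : P \in unitmx := unitarymx_unit uP.
clearbody P d => XE.
have dpos i : 0 < d 0 i.
  apply: ev; apply/eigenvalueP; exists (row i P).
    rewrite -row_mul {1}XE !mulmxA mulmxV // mul1mx row_mul row_diag_mx.
    by rewrite mulmxZl -rowE.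
  apply/eqP => /(congr1 (mulmx^~ (invmx P))); rewrite mul0mx rowE mulmxK //.
  by move/matrixP/(_ 0 i); rewrite !mxE !eqxx => /eqP; rewrite oner_eq0.
pose y := x *m P^t*.
have -> : (x *m X *m x^t*) 0 0 = \sum_i d 0 i * `|y 0 i| ^+ 2.
  rewrite {1}XE invmx_unitary // (_ : x *m _ *m _ = y *m diag_mx d *m y^t*).
    rewrite mxE; apply: eq_bigr => i _; rewrite mul_mx_diag mxE adjE normCK; ring.
  by rewrite /y adjM trmxCK !mulmxA.
have ge0 i : 0 <= d 0 i * `|y 0 i| ^+ 2 by rewrite mulr_ge0 ?exprn_ge0 // ltW.
rewrite lt_neqAle sumr_ge0 // andbT eq_sym; apply: contra x0.
rewrite psumr_eq0 // => /allP h.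
have y0 : y = 0.
  apply/rowP=> i; rewrite [RHS]mxE; apply/eqP; have := h i (mem_index_enum _).
  by rewrite /= mulf_eq0 gt_eqF //= sqrf_eq0 normr_eq0.
have uPJ : P^t* \in unitmx by rewrite adj_unit.
by rewrite -(mulmxK uPJ x) -/y y0 mul0mx.
Qed.

End PositiveDefinite.

(** * Existence and uniqueness of the system *)

Lemma large_upper (R : realType) (M : R) (P : R[i] -> Prop) :
  large P -> exists2 z, (M < complex.Im z)%R & P z.
Proof.
move=> [r r0 hr]; have rE : (complex.Re r)%:C = r by rewrite RRe_real // gtr0_real.
have r0' : (0 < complex.Re r)%R by rewrite -ltcR rE; exact: r0.
have M1 : (M < `|M| + complex.Re r + 1)%R.
  by rewrite -addrA (le_lt_trans (ler_norm M)) // ltrDl addr_gt0.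
(* A point high on the imaginary axis lies both in the half plane and near infinity. *)
exists (0 +i* (`|M| + complex.Re r + 1)) => //; apply: hr.
rewrite -rE; apply: norm_gtIm => /=.
by rewrite addrAC ltrDr ltr_wpDl.
Qed.

Lemma FG_quad (R : realType) m1 m2 (C : nat -> 'M[R[i]]_(m1 + m2)) : FG C ->
  exists (n : nat) (a S0 : 'M[R[i]]_n) (t1 : 'M[R[i]]_(n, m1)) (t2 : 'M[R[i]]_(n, m2)),
    [/\ pd S0, a *m S0 - S0 *m a^t* = 'i%R *: (t1 *m t1^t* + t2 *m t2^t*),
      reachable a t1, reachable a t2 & forall k, C k = potential a S0 t1 t2 k].
Proof.
move=> [n [a [S0 [t1 [t2 [_ [[[hS ev] e] c1 c2] hC]]]]]].
exists n, a, S0, t1, t2; split=> //; first exact: eigen_pd.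
  exact/reach_spaceP.
exact/reach_spaceP.
Qed.

Lemma FG_weyl_unique (R : realType) m1 m2 (phi : R[i] -> 'M[R[i]]_(m1, m2))
    (C C' : nat -> 'M[R[i]]_(m1 + m2)) :
  FG C -> FG C' -> weyl_function C phi -> weyl_function C' phi -> C = C'.
Proof.
move=> /FG_quad[n [a [S0 [t1 [t2 [dS e r1 r2 hC]]]]]].
move=> /FG_quad[n' [a' [S0' [t1' [t2' [dS' e' r1' r2' hC']]]]]] w w'.
have [M hM] := weyl_function_unique dS r1 e hC w.
have [M' hM'] := weyl_function_unique dS' r1' e' hC' w'.
apply/funext => k; rewrite hC hC' !potentialE.
apply: (pot_seq_unique k dS e r1 r2 dS' e' r1' r2'
  (Z := fun z => (Num.max M M' < complex.Im z)%R)).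
  by move=> P; apply: large_upper.
by move=> z; rewrite gt_max => /andP[/hM <- /hM' <-].
Qed.

Theorem theorem4p7 (R : realType) (m1 m2 : nat) (hm1 : (0 < m1)%N)
    (hm2 : (0 < m2)%N) (phi : R[i] -> 'M[R[i]]_(m1, m2))
    (phi_rat : rational_mxfun phi) (phi_sp : strictly_proper phi)
    (phi_neq0 : exists z, phi z <> 0) :
  exists! C : nat -> 'M[R[i]]_(m1 + m2),
    [/\ dirac_potential C, FG C & weyl_function C phi].
Proof.
have [n [A [B [c [hphi rB rc]]]]] : exists (n : nat) (A : 'M[R[i]]_n)
    (B : 'M[R[i]]_(n, m2)) (c : 'M[R[i]]_(m1, n)),
    [/\ realizes A B c phi, reachable A B & reachable A^T c^T].
  apply: rational_realization => [i j|eps e0].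
    by have [p [q [q0 _ h]]] := phi_rat i j; exists p, q.
  have [r r0 h] := phi_sp eps e0; exists r => // z hz i j; exact: h.
have [a [S0 [t1 [t2 [dS e r1 r2 hw]]]]] := quad_exists rB rc.
(* Order 0 makes [phi] vanish near infinity. The numerators are then zero, and coprimality makes the
   denominators constant, so [phi] vanishes at every point. *)
have n0 : (0 < n)%N.
  rewrite lt0n; apply/eqP => n0; have [z] := phi_neq0; apply.
  have phi0 : large (fun z => phi z = 0).
    apply: large_imp hphi => w ->.
    by apply/matrixP=> i j; rewrite !mxE big1 // => -[l hl]; exfalso; rewrite n0 in hl.
  apply/matrixP=> i j; rewrite mxE; have [p [q [q0 cop h]]] := phi_rat i j.
  have p0 : p = 0.
    apply/eqP/negPn/negP => /poly_large[m mp lp]; have [l lq ll] := poly_large q0.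
    have [w [[hp hq] hw0]] := large_ex (large_and (large_and lp ll) phi0).
    have qw : q.[w] != 0 by rewrite -normr_gt0 (lt_le_trans lq).
    have := h w qw; rewrite hw0 mxE => /esym/eqP; rewrite mulf_eq0 invr_eq0 (negPf qw) orbF.
    by move/eqP=> pw; move: hp; rewrite pw normr0 => /(lt_le_trans mp); rewrite ltxx.
  have [k k0 kq] : exists2 k, k != 0 & q = k%:P.
    by apply/size_poly1P; rewrite size_poly_eq1 -coprime0p -p0.
  by rewrite h kq hornerC // p0 horner0 mul0r.
exists (potential a S0 t1 t2).
have FGC : FG (potential a S0 t1 t2).
  exists n, a, S0, t1, t2; split=> //; split; last 2 first.
  - exact/reach_spaceP.
  - exact/reach_spaceP.
  - by split=> //; apply: pd_eigen.
have W : weyl_function (potential a S0 t1 t2) phi.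
  apply: (quad_weyl_function dS r1 e) => //.
  by apply: large_imp hphi => z ->; rewrite hw.
split.
  split=> // k; rewrite potentialE; exact: pot_seq_unitary.
by move=> C' [_ FGC' W']; apply: FG_weyl_unique W W'.
Qed.
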